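(* Let $G=\langle g_1\rangle\times\langle g_2\rangle\times\langle g_3\rangle\cong Z_2\times Z_2\times Z_2$ and let $\omega$ be the $3$-cocycle on $G$ given by $$\omega\left(g_1^{i_1}g_2^{i_2}g_3^{i_3},g_1^{j_1}g_2^{j_2}g_3^{j_3},g_1^{k_1}g_2^{k_2}g_3^{k_3}\right)=(-1)^{k_1j_2i_3},\qquad i_l,j_l,k_l\in\{0,1\}.$$ Let $V_1,V_2,V_3\in{}^G_G\mathcal{YD}^\omega$ be simple twisted Yetter-Drinfeld modules such that, for $1\le i\le3$, $\dim V_i=2$, $\deg(V_i)=g_i$, and $g_i\rhd v=-v$ for all $v\in V_i$. Then the Nichols algebra $\mathcal B(V_1\oplus V_2\oplus V_3)$ in ${}^G_G\mathcal{YD}^\omega$ is infinite-dimensional.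
   Context: All vector spaces are over an algebraically closed field $k$ of characteristic zero. For a finite abelian group $G$ and a normalized $3$-cocycle $\omega$ on $G$, ${}^G_G\mathcal{YD}^\omega$ is the category of Yetter-Drinfeld modules over the coquasi-Hopf algebra $(kG,\omega)$ (twisted Yetter-Drinfeld modules). Explicitly, an object is a $G$-graded space $V=\bigoplus_{g\in G}{}^gV$ (i.e. a $kG$-comodule with coaction $\delta$, where ${}^gV=\{v\mid\delta(v)=g\otimes v\}$) with linear maps $e\rhd-$ ($e\in G$) preserving each ${}^gV$ and satisfying $1\rhd v=v$ and $$e\rhd(f\rhd v)=\frac{\omega(g,e,f)\,\omega(e,f,g)}{\omega(e,g,f)}\,(ef)\rhd v,\qquad v\in{}^gV.$$ Morphisms preserve the grading and $\rhd$. The tensor product has the usual grading and, for $x\in{}^gX$, $y\in{}^hY$, $e\rhd(x\otimes y)=\frac{\omega(e,g,h)\omega(g,h,e)}{\omega(g,e,h)}(e\rhd x)\otimes(e\rhd y)$. The associativity constraint is $(x\otimes y)\otimes z\mapsto\omega(g,h,l)^{-1}x\otimes(y\otimes z)$ for $x,y,z$ of degrees $g,h,l$, and the braiding is $c(x\otimes y)=(g\rhd y)\otimes x$ for $x\in{}^gX$. The condition $\deg(V)=g$ means $V={}^gV$. For $V\in{}^G_G\mathcal{YD}^\omega$, the tensor algebra $T_\omega(V)=\bigoplus_{n\ge0}V^{\otimes\overrightarrow n}$, with $V^{\otimes\overrightarrow n}=(\cdots((V\otimes V)\otimes V)\cdots)\otimes V$, is a graded Hopf algebra in ${}^G_G\mathcal{YD}^\omega$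 in which the elements of $V$ are primitive. The Nichols algebra is $\mathcal B(V)=T_\omega(V)/I$, where $I$ is the unique maximal graded Hopf ideal generated by homogeneous elements of degree at least $2$. *)

(* Defs.v *)
From HB Require Import structures.
From mathcomp Require Import all_boot all_order all_algebra all_fingroup.
From mathcomp Require Import finmap.
From mathcomp.multinomials Require Import monalg.

Set Implicit Arguments.
Unset Strict Implicit.
Unset Printing Implicit Defensive.

Import GRing.Theory.
Local Open Scope ring_scope.

(* Finite-dimensional twisted Yetter-Drinfeld modules over a finite group [gT]
   and a function [omega : gT^3 -> k], meant to be a normalized 3-cocycle with
   nonzero values.  The cocycle identity is not needed to write the structure
   maps down, and is not required here. *)
Section Twist.

Variables (k : fieldType) (gT : finGroupType) (omega : gT -> gT -> gT -> k).

Definition act_coef (g e f : gT) : k :=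
  omega g e f * omega e f g / omega e g f.

Definition tensor_coef (e g h : gT) : k :=
  omega e g h * omega g h e / omega g e h.

Record yd_module (V : vectType k) := YDModule {
  yd_comp : gT -> {vspace V};
  yd_act : gT -> 'End(V);
  yd_direct : directv (\sum_(g : gT) yd_comp g);
  yd_full : (\sum_(g : gT) yd_comp g)%VS = fullv;
  yd_act_comp : forall e g v, v \in yd_comp g -> yd_act e v \in yd_comp g;
  yd_act1 : forall v, yd_act 1%g v = v;
  yd_actM : forall e f g v, v \in yd_comp g ->
    yd_act e (yd_act f v) = act_coef g e f *: yd_act (e * f)%g v
}.

Definition yd_has_deg (V : vectType k) (M : yd_module V) (g : gT) : Prop :=
  yd_comp M g = fullv.

Definition yd_submodule (V : vectType k) (M : yd_module V) (U : {vspace V}) :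
    Prop :=
  U = (\sum_(g : gT) (U :&: yd_comp M g))%VS
  /\ forall e, (yd_act M e @: U <= U)%VS.

Definition yd_simple (V : vectType k) (M : yd_module V) : Prop :=
  [/\ fullv <> 0%VS :> {vspace V}
    & forall U, yd_submodule M U -> U = 0%VS \/ U = fullv].

Section DirectSum.

Variables (V W : vectType k) (M : yd_module V) (N : yd_module W).

Definition pair_fun (f : 'End(V)) (h : 'End(W)) (x : V * W) : V * W :=
  (f x.1, h x.2).

Lemma pair_fun_linear f h : linear (pair_fun f h).
Proof. by move=> a x y; rewrite /pair_fun /= !linearP. Qed.

HB.instance Definition _ f h :=
  GRing.isLinear.Build k (V * W)%type (V * W)%type _ (pair_fun f h)
    (pair_fun_linear f h).

Definition sum_comp (g : gT) : {vspace V * W} :=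
  (linfun fst @^-1: yd_comp M g :&: linfun snd @^-1: yd_comp N g)%VS.

Definition sum_act (e : gT) : 'End((V * W)%type) :=
  linfun (pair_fun (yd_act M e) (yd_act N e)).

Lemma mem_sum_comp g x :
  (x \in sum_comp g) = (x.1 \in yd_comp M g) && (x.2 \in yd_comp N g).
Proof. by rewrite memv_cap -!memv_preim !lfunE. Qed.

Lemma sum_direct : directv (\sum_(g : gT) sum_comp g).
Proof.
apply/directv_sum_independent => us us_in us0 g _.
have us1 h : (us h).1 \in yd_comp M h /\ (us h).2 \in yd_comp N h.
  by have := us_in h isT; rewrite mem_sum_comp => /andP[].
have e1 : \sum_(h : gT) (us h).1 = 0.
  by rewrite -(raddf_sum (@fst V W)) us0.
have e2 : \sum_(h : gT) (us h).2 = 0.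
  by rewrite -(raddf_sum (@snd V W)) us0.
have i1 := directv_sum_independent (yd_direct M) _ (fun h _ => (us1 h).1) e1.
have i2 := directv_sum_independent (yd_direct N) _ (fun h _ => (us1 h).2) e2.
by rewrite [us g]surjective_pairing i1 // i2.
Qed.

Lemma sum_full : (\sum_(g : gT) sum_comp g)%VS = fullv.
Proof.
apply/vspaceP => x; rewrite memvf; apply/memv_sumP.
have /memv_sumP[u u_in xu] : x.1 \in (\sum_(g : gT) yd_comp M g)%VS.
  by rewrite yd_full memvf.
have /memv_sumP[w w_in xw] : x.2 \in (\sum_(g : gT) yd_comp N g)%VS.
  by rewrite yd_full memvf.
exists (fun g => (u g, w g)) => [g _|].
  by rewrite mem_sum_comp u_in ?w_in.
rewrite [x]surjective_pairing xu xw [RHS]surjective_pairing.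
by rewrite (raddf_sum (@fst V W)) (raddf_sum (@snd V W)).
Qed.

Lemma sum_act_comp e g x : x \in sum_comp g -> sum_act e x \in sum_comp g.
Proof.
by rewrite !mem_sum_comp lfunE => /andP[? ?] /=; rewrite !yd_act_comp.
Qed.

Lemma sum_act1 x : sum_act 1%g x = x.
Proof. by rewrite lfunE /= /pair_fun !yd_act1 -surjective_pairing. Qed.

Lemma sum_actM e f g x : x \in sum_comp g ->
  sum_act e (sum_act f x) = act_coef g e f *: sum_act (e * f)%g x.
Proof.
rewrite mem_sum_comp => /andP[x1 x2]; rewrite !lfunE /= /pair_fun /=.
by rewrite (yd_actM _ _ x1) (yd_actM _ _ x2).
Qed.

Definition yd_sum : yd_module (V * W)%type :=
  YDModule sum_direct sum_full sum_act_comp sum_act1 sum_actM.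

End DirectSum.

(* Possibly infinite-dimensional objects are given on a homogeneous basis: the
   underlying space of [A : based_yd] is the free module kfree (bidx A),
   [bdeg A b] is the degree of the basis vector [b], and [bact A e b] is the
   vector e |> b. *)
Record based_yd := BasedYD {
  bidx :> choiceType;
  bdeg : bidx -> gT;
  bact : gT -> bidx -> {malg k[bidx]}
}.

Local Notation kfree B := {malg k[B%type]}.

Definition bvec (B : choiceType) (b : B) : kfree B := mkmalgU b 1.

Definition mext (B : choiceType) (W : lmodType k) (f : B -> W)
    (x : kfree B) : W :=
  \sum_(b <- msupp x) x@_b *: f b.

Definition tens (B C : choiceType) (x : kfree B) (y : kfree C) :
    kfree (B * C) :=
  mext (fun b => mext (fun c => bvec (b, c)) y) x.

(* From here on, a linear map out of kfree B is given by its values B -> W on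
   the basis, and [mext] turns it into a function on vectors. *)
Definition tens_map (B C : choiceType) (B' C' : choiceType)
    (f : B -> kfree B') (h : C -> kfree C') (p : B * C) :
    kfree (B' * C') :=
  tens (f p.1) (h p.2).

Definition bcomp (B C D : choiceType) (f : B -> kfree C)
    (h : C -> kfree D) (b : B) : kfree D :=
  mext h (f b).

Definition byd_tensor (A B : based_yd) : based_yd :=
  BasedYD (bidx := (A * B)%type)
    (fun p => (bdeg p.1 * bdeg p.2)%g)
    (fun e p => tensor_coef e (bdeg p.1) (bdeg p.2)
                *: tens (bact e p.1) (bact e p.2)).

Definition assoc (A B C : based_yd) (p : A * B * C) : kfree (A * (B * C)) :=
  (omega (bdeg p.1.1) (bdeg p.1.2) (bdeg p.2))^-1
  *: bvec (p.1.1, (p.1.2, p.2)).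

Definition assoc_inv (A B C : based_yd) (p : A * (B * C)) :
    kfree (A * B * C) :=
  omega (bdeg p.1) (bdeg p.2.1) (bdeg p.2.2) *: bvec (p.1, p.2.1, p.2.2).

Definition braiding (A B : based_yd) (p : A * B) : kfree (B * A) :=
  tens (bact (bdeg p.1) p.2) (bvec p.1).

(* (A (x) B) (x) (C (x) D) -> (A (x) C) (x) (B (x) D), braiding the two middle
   factors. *)
Definition mid_braiding (A B C D : based_yd) :
    (A * B) * (C * D) -> kfree ((A * C) * (B * D)) :=
  bcomp (@assoc A B (byd_tensor C D))
 (bcomp (tens_map (@bvec A) (@assoc_inv B C D))
 (bcomp (tens_map (@bvec A) (tens_map (@braiding B C) (@bvec D)))
 (bcomp (tens_map (@bvec A) (@assoc C B D))
        (@assoc_inv A C (byd_tensor B D))))).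

Section OfModule.

Variables (V : vectType k) (M : yd_module V).

(* [hvec] enumerates a basis of V made of the chosen bases of its homogeneous
   components. *)
Definition hidx := {g : gT & 'I_(\dim (yd_comp M g))}.

Definition hvec (b : hidx) : V := (vbasis (yd_comp M (tag b)))`_(tagged b).

(* Since e |> preserves each component, e |> b has coordinates in the basis of
   the component of b only. *)
Definition hact (e : gT) (b : hidx) : kfree hidx :=
  \sum_(j < \dim (yd_comp M (tag b)))
    coord (vbasis (yd_comp M (tag b))) j (yd_act M e (hvec b))
    *: bvec (Tagged (fun g => 'I_(\dim (yd_comp M g))) j).

Definition byd_of : based_yd := BasedYD (bidx := hidx) (fun b => tag b) hact.

End OfModule.

(* The tensor algebra.  The list [:: b_n; ...; b_1], in this order, is the basis
   vector (...(b_1 (x) b_2) (x) ...) (x) b_n of the n-th left-bracketed tensor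
   power, so that [b :: w] is the tensor [w (x) b]. *)
Section TensorAlgebra.

Variable A : based_yd.

Definition word : choiceType := seq A.

Fixpoint wdeg (w : seq A) : gT :=
  if w is b :: w' then (wdeg w' * bdeg b)%g else 1%g.

Definition snoc (p : word * A) : kfree word := bvec (p.2 :: p.1 : word).

Fixpoint wact (e : gT) (w : seq A) : kfree word :=
  if w is b :: w' then
    tensor_coef e (wdeg w') (bdeg b) *: mext snoc (tens (wact e w') (bact e b))
  else bvec ([::] : word).

Definition talg : based_yd := BasedYD (bidx := word) wdeg wact.

(* u (w (x) b) = omega(|u|, |w|, |b|) (u w) (x) b, the image of u (x) (w (x) b)
   under the inverse associator, followed by the product of u and w. *)
Fixpoint wmul (u w : seq A) : kfree word :=
  if w is b :: w' then
    omega (wdeg u) (wdeg w') (bdeg b) *: mext snoc (tens (wmul u w') (bvec b))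
  else bvec (u : word).

Definition tmul (x y : kfree word) : kfree word :=
  mext (fun p : word * word => wmul p.1 p.2) (tens x y).

Definition tt_mul (x y : kfree (word * word)) : kfree (word * word) :=
  mext (bcomp (@mid_braiding talg talg talg talg)
          (tens_map (fun p : word * word => wmul p.1 p.2)
                    (fun p : word * word => wmul p.1 p.2)))
    (tens x y).

Definition primitive_coproduct (b : A) : kfree (word * word) :=
  bvec (([:: b], [::]) : word * word) + bvec (([::], [:: b]) : word * word).

Fixpoint wcoprod (w : seq A) : kfree (word * word) :=
  if w is b :: w' then tt_mul (wcoprod w') (primitive_coproduct b)
  else bvec (([::], [::]) : word * word).

Definition coprod : kfree word -> kfree (word * word) := mext wcoprod.

Definition counit (x : kfree word) : k := x@_[::].

(* The antipode satisfies S (w b) = mul (S (x) S) c (w (x) b), where c is the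
   braiding, and is -1 on generators. *)
Fixpoint wantipode (w : seq A) : kfree word :=
  if w is b :: w' then
    - tmul (mext (fun c => bvec ([:: c] : word)) (bact (wdeg w') b))
           (wantipode w')
  else bvec ([::] : word).

Definition antipode : kfree word -> kfree word := mext wantipode.

Definition tact (e : gT) : kfree word -> kfree word := mext (wact e).

Definition tcomp (g : gT) : kfree word -> kfree word :=
  mext (fun w : word => if wdeg w == g then bvec w else 0).

Definition tlen (n : nat) : kfree word -> kfree word :=
  mext (fun w : word => if size w == n then bvec w else 0).

Definition homogeneous (n : nat) (x : kfree word) : Prop := tlen n x = x.

Implicit Types I J S : kfree word -> Prop.

Definition subspace I : Prop :=
  I 0 /\ forall a x y, I x -> I y -> I (a *: x + y).

Definition ideal I : Prop :=
  subspace I /\ forall x y, I y -> I (tmul x y) /\ I (tmul y x).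

Definition generated_ideal S (x : kfree word) : Prop :=
  forall J, ideal J -> (forall y, S y -> J y) -> J x.

(* Membership in I (x) T + T (x) I. *)
Definition in_ideal_tensor I (z : kfree (word * word)) : Prop :=
  exists s : seq (kfree word * kfree word),
    (forall p, p \in s -> I p.1 \/ I p.2) /\ z = \sum_(p <- s) tens p.1 p.2.

Record graded_hopf_ideal I : Prop := GradedHopfIdeal {
  ghi_ideal : ideal I;
  ghi_comp : forall g x, I x -> I (tcomp g x);
  ghi_act : forall e x, I x -> I (tact e x);
  ghi_graded : forall n x, I x -> I (tlen n x);
  ghi_coprod : forall x, I x -> in_ideal_tensor I (coprod x);
  ghi_counit : forall x, I x -> counit x = 0;
  ghi_antipode : forall x, I x -> I (antipode x)
}.

Definition nichols_candidate I : Prop :=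
  graded_hopf_ideal I /\
  exists S, (forall x, S x -> exists2 n, (2 <= n)%N & homogeneous n x)
            /\ (forall x, I x <-> generated_ideal S x).

(* The sum of all candidates; [nichols_ideal_greatest] below shows that it is
   itself the greatest candidate. *)
Definition nichols_ideal (x : kfree word) : Prop :=
  exists s : seq (kfree word),
    (forall y, y \in s -> exists2 J, nichols_candidate J & J y)
    /\ x = \sum_(y <- s) y.

(* Finitely many classes span the quotient of T by [nichols_ideal]. *)
Definition nichols_finite_dim : Prop :=
  exists s : seq (kfree word), forall x, exists c : nat -> k,
    nichols_ideal (x - \sum_(i < size s) c i *: s`_i).

End TensorAlgebra.

Section Linearity.

Lemma mextEw (B : choiceType) (W : lmodType k) (f : B -> W) (d : {fset B}) x :
  (msupp x `<=` d)%fset -> mext f x = \sum_(b <- d) x@_b *: f b.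
Proof.
move=> le; rewrite /mext (big_fset_incl _ le) // => b _ /mcoeff_outdom ->.
by rewrite scale0r.
Qed.

Lemma mext_linear (B : choiceType) (W : lmodType k) (f : B -> W) :
  linear (mext f).
Proof.
move=> a x y; pose d := (msupp (a *: x + y) `|` (msupp x `|` msupp y))%fset.
rewrite (@mextEw _ _ _ d) ?fsubsetUl // (@mextEw _ _ _ d x); last first.
  by rewrite fsubsetU // fsubsetUl orbT.
rewrite (@mextEw _ _ _ d y); last by rewrite fsubsetU // fsubsetUr orbT.
rewrite scaler_sumr -big_split; apply: eq_bigr => b _ /=.
by rewrite mcoeffD mcoeffZ scalerDl scalerA.
Qed.

HB.instance Definition _ (B : choiceType) (W : lmodType k) (f : B -> W) :=
  GRing.isLinear.Build k (kfree B) W _ (mext f) (mext_linear f).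

Lemma mext_bvec (B : choiceType) (W : lmodType k) (f : B -> W) b :
  mext f (bvec b) = f b.
Proof.
rewrite (@mextEw _ _ _ [fset b]%fset) ?msuppU_le //.
by rewrite big_seq_fset1 mcoeffUU scale1r.
Qed.

Lemma tens_linearl (B C : choiceType) (y : kfree C) :
  linear (fun x : kfree B => tens x y).
Proof. exact: mext_linear. Qed.

Lemma tens_linearr (B C : choiceType) (x : kfree B) :
  linear (fun y : kfree C => tens x y).
Proof.
move=> a y z; rewrite /tens /mext scaler_sumr -big_split /=.
apply: eq_bigr => b _; rewrite -!/(mext _ _) linearP scalerDr.
by rewrite !scalerA mulrC.
Qed.

End Linearity.

Section Greatest.

Variable A : based_yd.

Notation T := (kfree (word A)).

Lemma subspaceD (I : T -> Prop) x y : subspace I -> I x -> I y -> I (x + y).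
Proof. by move=> [_ ID] Ix Iy; rewrite -[x]scale1r; apply: ID. Qed.

Lemma subspace_sum (I : T -> Prop) (s : seq T) : subspace I ->
  (forall y, y \in s -> I y) -> I (\sum_(y <- s) y).
Proof.
move=> subI; elim: s => [|y s IHs] Is; first by rewrite big_nil; case: subI.
rewrite big_cons; apply: subspaceD => //; first exact/Is/mem_head.
by apply: IHs => z zs; apply: Is; rewrite inE zs orbT.
Qed.

Lemma tmul_linearl y : linear (fun x : T => tmul x y).
Proof. by move=> a x z; rewrite /tmul tens_linearl linearP. Qed.

Lemma tmul_linearr x : linear (fun y : T => tmul x y).
Proof. by move=> a y z; rewrite /tmul tens_linearr linearP. Qed.

Lemma nichols_ideal_subspace : subspace (@nichols_ideal A).
Proof.
split=> [|a _ _ [s [Hs ->]] [t [Ht ->]]].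
  by exists [::]; rewrite big_nil; split.
exists ([seq a *: y | y <- s] ++ t); split; last first.
  by rewrite big_cat big_map scaler_sumr.
move=> y; rewrite mem_cat => /orP[/mapP[z zs ->]|/Ht //].
have [J cJ Jz] := Hs z zs; exists J => //.
have [[[[J0 JD] _] _ _ _ _ _ _] _] := cJ.
by rewrite -[_ *: _]addr0; apply: JD.
Qed.

Lemma candidate_sub (J : T -> Prop) x :
  nichols_candidate J -> J x -> nichols_ideal x.
Proof.
move=> cJ Jx; exists [:: x]; rewrite big_seq1; split=> // y.
by rewrite inE => /eqP->; exists J.
Qed.

Lemma nichols_ideal_lin (f : T -> T) : linear f ->
  (forall J y, nichols_candidate J -> J y -> J (f y)) ->
  forall x, nichols_ideal x -> nichols_ideal (f x).
Proof.
move=> linf fJ _ [s [Hs ->]].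
have [f0 fD] : f 0 = 0 /\ {morph f : x y / x + y}.
  have fD : {morph f : x y / x + y}.
    by move=> x y; have := linf 1 x y; rewrite !scale1r.
  by split=> //; apply: (@addrI _ (f 0)); rewrite -fD !addr0.
rewrite (big_morph f fD f0); elim: s Hs => [|y s IHs] Hs.
  by rewrite big_nil; case: nichols_ideal_subspace.
rewrite big_cons; apply: subspaceD; first exact: nichols_ideal_subspace.
  have [J cJ Jy] := Hs y (mem_head _ _).
  by apply: (candidate_sub cJ); apply: fJ.
by apply: IHs => z zs; apply: Hs; rewrite inE zs orbT.
Qed.

Lemma nichols_ideal_ideal : ideal (@nichols_ideal A).
Proof.
split; first exact: nichols_ideal_subspace.
move=> x y Iy; split.
  apply: (nichols_ideal_lin (tmul_linearr x)) Iy => J z [[[_ Jm] _ _ _ _ _ _] _].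
  by move=> /(Jm x)[].
apply: (nichols_ideal_lin (tmul_linearl x)) Iy => J z [[[_ Jm] _ _ _ _ _ _] _].
by move=> /(Jm x)[].
Qed.

Lemma nichols_ideal_greatest :
  nichols_candidate (@nichols_ideal A) /\
  (forall J, nichols_candidate J -> forall x : T, J x -> nichols_ideal x).
Proof.
split; last by move=> J cJ x; apply: candidate_sub.
split.
  split; first exact: nichols_ideal_ideal.
  - move=> g; apply: nichols_ideal_lin; first exact: mext_linear.
    by move=> J y [[_ H _ _ _ _ _] _]; apply: H.
  - move=> e; apply: nichols_ideal_lin; first exact: mext_linear.
    by move=> J y [[_ _ H _ _ _ _] _]; apply: H.
  - move=> n; apply: nichols_ideal_lin; first exact: mext_linear.
    by move=> J y [[_ _ _ H _ _ _] _]; apply: H.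
  - move=> _ [s [Hs ->]]; rewrite /coprod raddf_sum.
    elim: s Hs => [|y s IHs] Hs.
      by exists [::]; rewrite !big_nil; split.
    have [|t [Ht e]] := IHs.
      by move=> z zs; apply: Hs; rewrite inE zs orbT.
    have [J cJ Jy] := Hs y (mem_head _ _).
    have [[_ _ _ _ H _ _] _] := cJ; have [u [Hu e']] := H y Jy.
    exists (u ++ t); rewrite big_cat big_cons e /= -e'; split=> // p.
    rewrite mem_cat => /orP[/Hu|/Ht //].
    by case=> Jp; [left|right]; apply: (candidate_sub cJ).
  - move=> _ [s [Hs ->]]; rewrite /counit raddf_sum big_seq big1 // => y ys.
    by have [J [[_ _ _ _ _ H _] _] Jy] := Hs y ys; apply: H.
  - apply: nichols_ideal_lin; first exact: mext_linear.
    by move=> J y [[_ _ _ _ _ _ H] _]; apply: H.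
exists (fun x => (exists2 n, (2 <= n)%N & homogeneous n x) /\ nichols_ideal x).
split=> [x [] //|x]; split=> [[s [Hs ->]] K idK SK|Hx].
  apply: subspace_sum => [|y ys]; first by case: idK.
  have [J cJ Jy] := Hs y ys; have [_ [S [S2 JS]]] := cJ.
  have /JS := Jy; apply=> // z Sz; apply: SK; split; first exact: S2.
  by apply: (candidate_sub cJ); apply/JS => K' _; apply.
by apply: Hx; [exact: nichols_ideal_ideal|move=> y []].
Qed.

End Greatest.

End Twist.

(* Main.v *)
From HB Require Import structures.
Require Import Defs.
From mathcomp Require Import all_boot all_order all_algebra all_fingroup.
From mathcomp Require Import finmap.
From mathcomp.multinomials Require Import monalg.

Set Implicit Arguments.
Unset Strict Implicit.
Unset Printing Implicit Defensive.

Import GRing.Theory.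
Local Open Scope ring_scope.

(** The Nichols ideal contains nothing of degree less than 2 and is stable under
the skew derivations [partial f], which apply a functional [f] on the space of
generators to the last tensor factor of the coproduct.  Hence an element of the
tensor algebra from which some sequence of skew derivations produces a nonzero
scalar is not in the ideal.  On the other hand, if the Nichols algebra is
finite-dimensional, the ideal contains everything of large degree.  So it is
enough to find elements of arbitrarily large degree that can be differentiated
down to a nonzero scalar.

Because of the cocycle, the two generators other than [g_i] act on [V_i] by
anticommuting involutions.  So [V_i] has a basis on which one of them is
diagonal with eigenvalues 1 and -1 and the other one exchanges the two vectors
([pauli_pair], [letter_basis]).  Call these bases x+, x-, then y+, y-, then z+,
z-.  Skew derivations move past right multiplications by these six letters at
the cost of a sign and of a change of letter ([dletter_rletter]).

Let h be the product of the three generators.  In degree 3 there are two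
elements P+ and P- (the list [root_words]) of degree h that are killed by all
skew derivations along [V_1] and [V_2], are eigenvectors of h with eigenvalue a
square root i of -1, and are dual, up to the factor i - 1, to two compositions
D+ and D- of three skew derivations.  Therefore P+ and P- behave like two
generators with diagonal braiding all of whose entries are i
([root_der_mul]).  The generalised Dynkin diagram of this braiding has two
vertices i joined by an edge -1 = i^-2, that is, the affine type A_1^(1), and
its Nichols algebra is infinite-dimensional.

Concretely, the imaginary root vector Z = P+ P- - i P- P+ braids with itself by
i^4 = 1, so that it behaves like the variable of a polynomial ring:
D+ D- maps Z^(n+1) to 2 (n+1) (i - 1)^2 Z^n ([delta_powerP]).  In
characteristic zero it follows that no power of Z, an element of degree 6 n, is
in the Nichols ideal. *)

(** * Free modules *)

Local Notation kfree k B := {malg k[B%type]}.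

Section FreeModule.
Variable k : fieldType.
Implicit Types B C : choiceType.

Definition supported B (P : B -> bool) (x : kfree k B) : Prop :=
  forall b, b \in msupp x -> P b.

Lemma supported_bvec B (P : B -> bool) b : P b -> supported P (bvec k b).
Proof. by move=> Pb c; rewrite msuppU oner_eq0 inE => /eqP->. Qed.

Lemma supportedP B (P : B -> bool) (x : kfree k B) :
  supported P x <-> forall b, ~~ P b -> x@_b = 0.
Proof.
split=> [sx b|x0 b bx].
  by apply: contraNeq; rewrite mcoeff_neq0 => /sx.
by apply: contraLR bx => /x0/eqP; rewrite mcoeff_eq0.
Qed.

Lemma supported0 B (P : B -> bool) : supported P (0 : kfree k B).
Proof. by apply/supportedP => b _; rewrite mcoeff0. Qed.

Lemma supportedD B (P : B -> bool) (x y : kfree k B) :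
  supported P x -> supported P y -> supported P (x + y).
Proof.
move=> /supportedP sx /supportedP sy; apply/supportedP => b nb.
by rewrite mcoeffD sx ?sy ?addr0.
Qed.

Lemma supportedZ B (P : B -> bool) a (x : kfree k B) :
  supported P x -> supported P (a *: x).
Proof.
by move=> /supportedP sx; apply/supportedP => b nb; rewrite mcoeffZ sx ?mulr0.
Qed.

Lemma supported_mext B C (P : B -> bool) (Q : C -> bool)
    (f : B -> kfree k C) x :
  (forall b, P b -> supported Q (f b)) -> supported P x ->
  supported Q (mext f x).
Proof.
move=> fPQ sx; rewrite /mext big_seq; apply: big_ind => [||b /sx/fPQ].
- exact: supported0.
- exact: supportedD.
- exact: supportedZ.
Qed.

Lemma eq_mext B (P : B -> bool) (W : lmodType k) (f h : B -> W) x :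
  (forall b, P b -> f b = h b) -> supported P x -> mext f x = mext h x.
Proof.
by move=> fh sx; rewrite /mext [LHS]big_seq [RHS]big_seq;
  apply: eq_bigr => b /sx/fh->.
Qed.

Lemma mext_id B (x : kfree k B) : mext (@bvec k B) x = x.
Proof.
rewrite [RHS]monalgE /mext; apply: eq_bigr => b _; apply/malgP => c.
by rewrite mcoeffZ !mcoeffU mulr_natr.
Qed.

Lemma linear_mext B (U W : lmodType k) (f : {linear U -> W}) (h : B -> U) x :
  f (mext h x) = mext (fun b => f (h b)) x.
Proof.
by rewrite /mext linear_sum; apply: eq_bigr => b _; rewrite linearZ.
Qed.

Lemma mextDf B (W : lmodType k) (f h : B -> W) x :
  mext f x + mext h x = mext (fun b => f b + h b) x.
Proof.
by rewrite /mext -big_split; apply: eq_bigr => b _; rewrite scalerDr.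
Qed.

Lemma mextZf B (W : lmodType k) a (f : B -> W) x :
  a *: mext f x = mext (fun b => a *: f b) x.
Proof.
by rewrite /mext scaler_sumr; apply: eq_bigr => b _; rewrite !scalerA mulrC.
Qed.

Lemma mext_scalel B (W : lmodType k) (phi : B -> k^o) (v : W) x :
  mext phi x *: v = mext (fun b => phi b *: v) x.
Proof.
by rewrite /mext scaler_suml; apply: eq_bigr => b _; rewrite scalerA.
Qed.

Lemma mext0 B (W : lmodType k) x : mext (fun=> 0 : W) (x : kfree k B) = 0.
Proof. by rewrite /mext big1 // => b _; rewrite scaler0. Qed.

Lemma mextD B (W : lmodType k) (f : B -> W) x y :
  mext f (x + y) = mext f x + mext f y.
Proof. exact: linearD. Qed.

Lemma mextZ B (W : lmodType k) (f : B -> W) a x :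
  mext f (a *: x) = a *: mext f x.
Proof. exact: linearZ. Qed.

Lemma mext_mext B C (W : lmodType k) (f : C -> W) (h : B -> kfree k C) x :
  mext f (mext h x) = mext (fun b => mext f (h b)) x.
Proof. exact: linear_mext. Qed.

Lemma linear_expand B (W : lmodType k) (f : {linear kfree k B -> W}) x :
  f x = mext (fun b => f (bvec k b)) x.
Proof. by rewrite -linear_mext mext_id. Qed.

Lemma supported_linear B C (P : B -> bool) (Q : C -> bool)
    (f : {linear kfree k B -> kfree k C}) x :
  (forall b, P b -> supported Q (f (bvec k b))) -> supported P x ->
  supported Q (f x).
Proof.
by move=> fPQ sx; rewrite linear_expand; apply: supported_mext sx.
Qed.

Lemma supported_sub B (P Q : B -> bool) (x : kfree k B) :
  (forall b, P b -> Q b) -> supported P x -> supported Q x.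
Proof. by move=> PQ sx b /sx/PQ. Qed.

Lemma supportedT B (x : kfree k B) : supported (fun=> true) x.
Proof. by []. Qed.

Lemma tens_bvecl B C (b : B) (y : kfree k C) :
  tens (bvec k b) y = mext (fun c => bvec k (b, c)) y.
Proof. by rewrite /tens mext_bvec. Qed.

Lemma tens_bvecr B C (x : kfree k B) (c : C) :
  tens x (bvec k c) = mext (fun b => bvec k (b, c)) x.
Proof.
by apply: (eq_mext _ (@supportedT _ _)) => b _; rewrite mext_bvec.
Qed.

Lemma tens_bvec B C (b : B) (c : C) :
  tens (bvec k b) (bvec k c) = bvec k (b, c).
Proof. by rewrite tens_bvecl mext_bvec. Qed.

HB.instance Definition _ B C (x : kfree k B) :=
  GRing.isLinear.Build k (kfree k C) (kfree k (B * C)) _ (tens x)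
    (@tens_linearr k B C x).

Lemma tens_mextl B C D (f : B -> kfree k C) (x : kfree k B) (y : kfree k D) :
  tens (mext f x) y = mext (fun b => tens (f b) y) x.
Proof. by rewrite {1}/tens linear_mext. Qed.

Lemma supported_tens B C (P : B -> bool) (Q : C -> bool) x y :
  supported P x -> supported Q y ->
  supported (fun p : B * C => P p.1 && Q p.2) (tens x y : kfree k _).
Proof.
move=> sx sy; apply: supported_mext sx => b Pb.
by apply: supported_mext sy => c Qc; apply: supported_bvec; rewrite Pb.
Qed.

End FreeModule.

(** * Skew derivations of the tensor algebra *)

Section TensorAlgebra.

Variables (k : fieldType) (gT : finGroupType) (omega : gT -> gT -> gT -> k).
Hypotheses (omega1l : forall a b, omega 1%g a b = 1)
  (omega1m : forall a b, omega a 1%g b = 1)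
  (omega1r : forall a b, omega a b 1%g = 1)
  (gTC : forall a b : gT, (a * b = b * a)%g).
Variable A : based_yd k gT.
Hypothesis bact_deg : forall e (b : A),
  supported (fun c => bdeg c == bdeg b) (bact e b).
Hypothesis bact1 : forall b : A, bact 1%g b = bvec k b.

Local Notation T := (kfree k (word A)).
Local Notation TT := (kfree k (word A * word A)).
Implicit Types (u v w : word A) (b c : A) (x y : T) (f : A -> k).

Definition letter_mul (l : kfree k A) (y : T) : T :=
  mext (@snoc k gT A) (tens y l).

Lemma mid_braidingE u v s t :
  mid_braiding omega (A := talg omega A) (B := talg omega A)
     (C := talg omega A) (D := talg omega A) ((u, v), (s, t)) =
  ((omega (wdeg u) (wdeg v) (wdeg s * wdeg t)%g)^-1
    * omega (wdeg v) (wdeg s) (wdeg t)) *: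
  mext (fun s' : word A => ((omega (wdeg s') (wdeg v) (wdeg t))^-1
            * omega (wdeg u) (wdeg s') (wdeg v * wdeg t)%g)
          *: bvec k ((u, s'), (v, t))) (wact omega (wdeg v) s).
Proof.
rewrite /mid_braiding /bcomp {1}/assoc linearZ /= mext_bvec /tens_map /=.
rewrite -scalerA; congr (_ *: _).
rewrite {1}/assoc_inv /= !linearZ /= tens_bvec mext_bvec /=; congr (_ *: _).
rewrite /braiding /= !tens_bvecr tens_bvecl.
rewrite !linear_mext; apply: (eq_mext _ (@supportedT _ _ _)) => s' _.
rewrite /= !mext_bvec /= linearZ /= tens_bvec linearZ /= mext_bvec /=.
by rewrite scalerA.
Qed.

Lemma wact1 e b :
  wact omega e [:: b] = mext (fun c => bvec k ([:: c] : word A)) (bact e b).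
Proof.
rewrite /= /tensor_coef !(omega1l, omega1m) divr1 mulr1 scale1r tens_bvecl.
rewrite linear_mext; apply: (eq_mext _ (@supportedT _ _ _)) => c _.
by rewrite /= mext_bvec.
Qed.

Lemma tt_mul_letterl u v b :
  tt_mul omega (bvec k (u, v)) (bvec k ([:: b] : word A, [::] : word A)) =
  (omega (wdeg u) (bdeg b) (wdeg v) / omega (wdeg u) (wdeg v) (bdeg b)) *:
  mext (fun c => bvec k ((c :: u : word A), v)) (bact (wdeg v) b).
Proof.
rewrite /tt_mul tens_bvec mext_bvec /bcomp mid_braidingE linearZ /= mulg1.
rewrite -/(wact omega (wdeg v) [:: b]) wact1.
rewrite !linear_mext; apply: (eq_mext _ (@bact_deg _ _)) => c /eqP dc /=.
rewrite !mext_bvec linearZ /= !mext_bvec /tens_map /= tens_bvecl linear_mext /=.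
rewrite !(mul1g, mulg1) !(omega1r, omega1m) invr1 mul1r mulr1 scale1r.
by rewrite !mext_bvec /snoc scalerA dc.
Qed.

Lemma tt_mul_letterr u v b :
  tt_mul omega (bvec k (u, v)) (bvec k ([::] : word A, [:: b] : word A)) =
  (omega (wdeg u) (wdeg v) (bdeg b))^-1 *: bvec k (u, (b :: v : word A)).
Proof.
rewrite /tt_mul tens_bvec mext_bvec /bcomp mid_braidingE linearZ /= mext_bvec.
rewrite linearZ /= mext_bvec /tens_map /= tens_bvec mext_bvec linearZ /=.
rewrite /snoc scalerA linearZ /= tens_bvec !(mul1g, mulg1).
rewrite !(omega1l, omega1r, omega1m).
by rewrite invr1 !(mul1r, mulr1) scale1r.
Qed.

Lemma tt_mul_mextl (B : choiceType) (F : B -> TT) (x : kfree k B) (y : TT) :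
  tt_mul omega (mext F x) y = mext (fun i => tt_mul omega (F i) y) x.
Proof. by rewrite /tt_mul tens_mextl linear_mext. Qed.

Lemma tt_mulDr (x y z : TT) :
  tt_mul omega x (y + z) = tt_mul omega x y + tt_mul omega x z.
Proof. by rewrite /tt_mul !linearD. Qed.

Lemma tt_mul_primitive (x : TT) b :
  tt_mul omega x (primitive_coproduct b) =
  mext (fun p => (omega (wdeg p.1) (bdeg b) (wdeg p.2)
                   / omega (wdeg p.1) (wdeg p.2) (bdeg b)) *:
                 mext (fun c => bvec k ((c :: p.1 : word A), p.2))
                   (bact (wdeg p.2) b)
         + (omega (wdeg p.1) (wdeg p.2) (bdeg b))^-1 *:
                 bvec k (p.1, (b :: p.2 : word A))) x.
Proof.
rewrite -{1}(mext_id x) tt_mul_mextl.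
apply: (eq_mext _ (@supportedT _ _ _)) => -[u v] _ /=.
by rewrite /primitive_coproduct tt_mulDr tt_mul_letterl tt_mul_letterr.
Qed.

(** The map [id (x) phi] from the tensor square to the tensor algebra. *)
Definition contract (phi : word A -> k) : TT -> T :=
  mext (fun p => phi p.2 *: bvec k p.1).

HB.instance Definition _ phi := GRing.Linear.on (contract phi).

Definition on_empty (v : word A) : k := if v is [::] then 1 else 0.
Definition on_letters (f : A -> k) (v : word A) : k :=
  if v is [:: b] then f b else 0.

Definition partial (f : A -> k) : T -> T :=
  contract (on_letters f) \o coprod omega (A := A).

HB.instance Definition _ f := GRing.Linear.on (partial f).

Lemma contract_tt_mul phi (x : TT) b :
  contract phi (tt_mul omega x (primitive_coproduct b)) =
  mext (fun p => (phi p.2 * (omega (wdeg p.1) (bdeg b) (wdeg p.2)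
                   / omega (wdeg p.1) (wdeg p.2) (bdeg b))) *:
                 mext (fun c => bvec k (c :: p.1 : word A))
                   (bact (wdeg p.2) b)
         + (phi (b :: p.2) / omega (wdeg p.1) (wdeg p.2) (bdeg b)) *:
                 bvec k p.1) x.
Proof.
rewrite tt_mul_primitive /contract mext_mext.
apply: (eq_mext _ (@supportedT _ _ _)) => -[u v] _ /=.
rewrite mextD; congr (_ + _); last by rewrite mextZ mext_bvec scalerA mulrC.
rewrite mextZ mext_mext [phi v * _]mulrC -[RHS]scalerA; congr (_ *: _).
rewrite mextZf.
by apply: (eq_mext _ (@supportedT _ _ _)) => c _; rewrite mext_bvec.
Qed.

(** One of the two counit laws of the coproduct. *)
Lemma contract_empty_coprod w : contract on_empty (wcoprod omega w) = bvec k w.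
Proof.
elim: w => [|b w IHw] /=.
  by rewrite /contract mext_bvec scale1r.
rewrite contract_tt_mul.
transitivity (mext (fun p => on_empty p.2 *: bvec k (b :: p.1 : word A))
                (wcoprod omega w)).
  apply: (eq_mext _ (@supportedT _ _ _)) => -[u [|c v]] _ /=.
    rewrite bact1 mext_bvec !(omega1r, omega1m) divr1 !mul1r scale1r.
    by rewrite mul0r scale0r addr0.
  by rewrite !mul0r !scale0r addr0.
transitivity (mext (fun u => bvec k (b :: u : word A))
                (contract on_empty (wcoprod omega w))).
  rewrite /contract linear_mext; apply: (eq_mext _ (@supportedT _ _ _)) => p _.
  by rewrite linearZ /= mext_bvec.
by rewrite IHw mext_bvec.
Qed.

(** The product of the coproduct of [w] with [b (x) 1 + 1 (x) b] has its last
factor in degree 1 in two ways: [b] itself, where the rest is [w] by the counit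
law, or the last letter of a term of the coproduct of [w], past which [b] has
been braided. *)
Lemma partial_cons f g b w : (forall c, f c != 0 -> bdeg c = g) ->
  partial f (bvec k (b :: w : word A)) = f b *: bvec k w +
  mext (fun u => (omega (wdeg u) (bdeg b) g / omega (wdeg u) g (bdeg b)) *:
          mext (fun c => bvec k (c :: u : word A)) (bact g b))
    (partial f (bvec k w)).
Proof.
move=> fg; rewrite /partial /coprod /= !mext_bvec /= contract_tt_mul.
rewrite -[in f b *: _](contract_empty_coprod w) /contract linear_mext /=.
rewrite linear_mext /= mextDf.
apply: (eq_mext _ (@supportedT _ _ _)) => -[u v] _ /=.
rewrite [X in _ = _ + X]linearZ /= mext_bvec addrC !scalerA.
case: v => [|c [|d v]] /=.
- by rewrite !omega1m divr1 mulr1 !mul0r !scale0r.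
- have [->|/fg fc] := eqVneq (f c) 0; first by rewrite !(mulr0, mul0r, scale0r).
  by rewrite !mul1g mulr0 fc mul0r !scale0r.
- by rewrite !(mulr0, mul0r, scale0r).
Qed.

Lemma partial_nil f : partial f (bvec k ([::] : word A)) = 0.
Proof.
by rewrite /partial /coprod /= mext_bvec /= /contract mext_bvec scale0r.
Qed.

Lemma partial_deg f g h x : (forall c, f c != 0 -> bdeg c = g) ->
  supported (fun w => wdeg w == h) x ->
  supported (fun w => wdeg w * g == h)%g (partial f x).
Proof.
move=> fg; apply: supported_linear => w /eqP <-{h}.
elim: w => [|b w IHw] /=.
  by rewrite partial_nil; apply: supported0.
rewrite (partial_cons _ _ fg); apply: supportedD.
  have [->|/fg <-] := eqVneq (f b) 0.
    by rewrite scale0r; apply: supported0.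
  by apply/supportedZ/supported_bvec.
apply: supported_mext IHw => u /eqP ug; apply: supportedZ.
apply: supported_mext (@bact_deg _ _) => c /eqP bc; apply: supported_bvec.
by rewrite /= bc -ug -!mulgA [(g * _)%g]gTC.
Qed.

Lemma letter_mul_deg l y g h :
  supported (fun c => bdeg c == g) l -> supported (fun w => wdeg w == h) y ->
  supported (fun w => wdeg w == h * g)%g (letter_mul l y).
Proof.
move=> sl sy; apply: supported_mext (supported_tens sy sl) => -[w c] /= /andP[].
by move=> /eqP <- /eqP <-; apply: supported_bvec.
Qed.

Lemma letter_mul_size l y n :
  supported (fun w => size w == n) y ->
  supported (fun w : word A => size w == n.+1) (letter_mul l y).
Proof.
move=> sy; apply: supported_mext (supported_tens sy (@supportedT _ _ l)).
by move=> -[w c] /= /andP[/eqP <- _]; apply: supported_bvec.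
Qed.

Lemma letter_mul_bvec l w :
  letter_mul l (bvec k w) = mext (fun c => bvec k (c :: w : word A)) l.
Proof.
rewrite /letter_mul tens_bvecl linear_mext.
by apply: (eq_mext _ (@supportedT _ _ _)) => c _; rewrite /= mext_bvec.
Qed.

HB.instance Definition _ l :=
  GRing.isLinear.Build k T T _ (letter_mul l)
    (fun a x y => etrans (congr1 _ (tens_linearl l a x y)) (linearP _ _ _ _)).

Lemma letter_mulE l x :
  letter_mul l x = mext (fun w => mext (fun c => bvec k (c :: w : word A)) l) x.
Proof.
rewrite -{1}(mext_id x) linear_mext.
by apply: (eq_mext _ (@supportedT _ _ _)) => w _; apply: letter_mul_bvec.
Qed.

Lemma letter_mul_mextl (B : choiceType) (F : B -> kfree k A) (l : kfree k B) x :
  letter_mul (mext F l) x = mext (fun i => letter_mul (F i) x) l.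
Proof.
by rewrite /letter_mul (@linear_mext _ _ _ _ (tens x)) mext_mext.
Qed.

Lemma letter_mulZl (a : k) l x : letter_mul (a *: l) x = a *: letter_mul l x.
Proof. by rewrite /letter_mul linearZ_LR mextZ. Qed.

(** The twisted Leibniz rule for a product with a generator: the degree [h] of
the derivative of [x] enters through the associativity constraints. *)
Lemma partial_letter_mul f g m h l x : (forall c, f c != 0 -> bdeg c = g) ->
  supported (fun c => bdeg c == m) l ->
  supported (fun w => wdeg w == h * g)%g x ->
  partial f (letter_mul l x) = mext (f : A -> k^o) l *: x +
    (omega h m g / omega h g m) *:
      letter_mul (mext (bact g) l) (partial f x).
Proof.
move=> fg sl sx.
have -> : partial f (letter_mul l x) =
    mext (fun w => partial f (letter_mul l (bvec k w))) x.
  exact: (linear_expand (partial f \o letter_mul l)).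
have -> : letter_mul (mext (bact g) l) (partial f x) =
    mext (fun w => letter_mul (mext (bact g) l) (partial f (bvec k w))) x.
  exact: (linear_expand (letter_mul (mext (bact g) l) \o partial f)).
rewrite -[X in _ *: X + _](mext_id x) !mextZf mextDf.
apply: eq_mext sx => w /eqP dw.
have sp : supported (fun u => wdeg u == h) (partial f (bvec k w)).
  have sw : supported (fun u => wdeg u == h * g)%g (bvec k w).
    by apply: supported_bvec; rewrite dw.
  by apply: supported_sub (partial_deg fg sw) => u; rewrite (inj_eq (mulIg g)).
rewrite letter_mul_bvec linear_mext letter_mul_mextl.
rewrite mext_scalel mextZf mextDf; apply: eq_mext sl => b /eqP db.
rewrite /= (partial_cons _ _ fg); congr (_ + _); rewrite letter_mulE mextZf.
by apply: eq_mext sp => u /eqP du; rewrite du db.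
Qed.

(** * The Nichols ideal *)

Lemma wmul_size u v :
  supported (fun w : word A => size w == size u + size v)%N (wmul omega u v).
Proof.
elim: v => [|b v IHv] /=; first by apply: supported_bvec; rewrite addn0.
apply: supportedZ; rewrite addnS; exact: letter_mul_size IHv.
Qed.

(** The elements without components of degree 0 and 1 form an ideal, which
contains the generators of every candidate. *)
Lemma nichols_ideal_supported x :
  nichols_ideal omega x -> supported (fun w : word A => 2 <= size w)%N x.
Proof.
pose big w := (2 <= size w)%N.
have subS : subspace (supported big : T -> Prop).
  split=> [|a y z sy sz]; first exact: supported0.
  by apply: supportedD => //; apply: supportedZ.
have idS : ideal omega (supported big : T -> Prop).
  split=> // y z sz; split.
    apply: supported_mext (supported_tens (@supportedT _ _ y) sz).
    by move=> -[u v] /= v2 w /wmul_size/eqP sw; rewrite /big sw ltn_addl.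
  apply: supported_mext (supported_tens sz (@supportedT _ _ y)) => -[u v] /=.
  by rewrite andbT => v2 w /wmul_size/eqP sw; rewrite /big sw ltn_addr.
move=> [s [Hs ->]]; apply: subspace_sum => // y /Hs[J [_ [S [S2 JS]]] /JS].
apply=> // z /S2[n n2 <-]; apply: supported_mext (@supportedT _ _ z) => w _.
by case: eqP => [wn|_]; [apply: supported_bvec; rewrite /big wn|
                         apply: supported0].
Qed.

Lemma contract_tens phi y z :
  contract phi (tens y z) = mext (phi : word A -> k^o) z *: y.
Proof.
rewrite -[in RHS](mext_id y) mextZf /contract /tens linear_mext.
apply: (eq_mext _ (@supportedT _ _ _)) => b _; rewrite linear_mext mext_scalel.
by apply: (eq_mext _ (@supportedT _ _ _)) => c _; rewrite /= mext_bvec.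
Qed.

(** The ideal is a coideal, and a functional on the generators vanishes on its
second tensor factors, because they have no component of degree 1. *)
Lemma nichols_ideal_partial f x :
  nichols_ideal omega x -> nichols_ideal omega (partial f x).
Proof.
have [[gI _] _] := nichols_ideal_greatest omega A.
have [subI _] := ghi_ideal gI.
have IZ a y : nichols_ideal omega y -> nichols_ideal omega (a *: y).
  by move=> Iy; rewrite -[_ *: _]addr0; apply: subI.2 => //; apply: subI.1.
move=> /(ghi_coprod gI)[s [Hs e]]; rewrite /partial /= e linear_sum.
rewrite big_seq; apply: big_ind => [|y z|p /Hs Ip]; first exact: subI.1.
  exact: subspaceD subI.
rewrite /= contract_tens; case: Ip => [/IZ//|/nichols_ideal_supported s2].
rewrite (eq_mext (h := fun=> 0) _ s2) ?mext0 ?scale0r; first exact: subI.1.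
by case=> [|c [|d v]].
Qed.

(** An element of degree [n] is congruent to a combination of the finitely many
spanning elements; when [n] exceeds all their degrees, the component of degree
[n] of this congruence says that the element is in the ideal. *)
Lemma nichols_finite_dim_degree : nichols_finite_dim omega A ->
  exists N, forall n x, (N <= n)%N ->
    supported (fun w : word A => size w == n) x -> nichols_ideal omega x.
Proof.
case=> s Hs; exists (\max_(y <- s) \max_(w <- msupp y) (size w).+1)%N.
move=> n x ns sx.
have [c Ic] := Hs x.
have [[gI _] _] := nichols_ideal_greatest omega A.
have := ghi_graded gI n Ic.
have ss (i : 'I_(size s)) : supported (fun w : word A => size w < n)%N s`_i.
  move=> w wi; apply: leq_trans ns.
  apply: leq_trans (leq_bigmax_seq _ (mem_nth 0 (ltn_ord i)) isT).
  exact: (@leq_bigmax_seq _ _ xpredT (fun w : word A => (size w).+1) w wi isT).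
have t0 i : tlen n (c i *: s`_i) = 0 :> T.
  have [si|/(nth_default 0)->] := ltnP i (size s); last first.
    by rewrite scaler0 /tlen linear0.
  rewrite /tlen mextZ (eq_mext (h := fun=> 0) _ (ss (Ordinal si))).
    by rewrite mext0 scaler0.
  move=> w.
  by case: eqP => // ->; rewrite ltnn.
have -> : tlen n (x - \sum_(i < size s) c i *: s`_i) = x.
  have tx : tlen n x = x.
    rewrite /tlen (eq_mext (h := @bvec k _) _ sx) => [|w -> //].
    exact: mext_id.
  have -> : tlen n (x - \sum_(i < size s) c i *: s`_i)
      = tlen n x - \sum_(i < size s) tlen n (c i *: s`_i).
    by rewrite /tlen linearB; congr (_ - _); apply: linear_sum.
  by rewrite tx big1 ?subr0.
by [].
Qed.

End TensorAlgebra.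

(** * Straightening words in six letters *)

(** The sign [true] is +, and the index in ['I_3] is the number of the module.
A [degree] lists the exponents of the three generators of the group. *)
Definition letter := ('I_3 * bool)%type.
Definition degree := (bool * bool * bool)%type.

Definition lx (s : bool) : letter := (@Ordinal 3 0 isT, s).
Definition ly (s : bool) : letter := (@Ordinal 3 1 isT, s).
Definition lz (s : bool) : letter := (@Ordinal 3 2 isT, s).

Definition deg_mul (g h : degree) : degree :=
  (g.1.1 (+) h.1.1, g.1.2 (+) h.1.2, g.2 (+) h.2).
Definition deg1 : degree := (false, false, false).
Definition ldeg (a : letter) : degree :=
  (a.1 == 0 :> nat, a.1 == 1 :> nat, a.1 == 2 :> nat)%N.

(** The exponent of -1 in the cocycle. *)
Definition twist (a b c : degree) : bool := [&& a.2, b.1.2 & c.1.1].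

(** The [i]-th generator of the group maps the letter [b] to a letter, up to a
sign: it is -1 on its own module; on the module of [b], the first of the two
other generators is diagonal and the second one exchanges the two letters. *)
Definition lact (i : 'I_3) (b : letter) : bool * letter :=
  if i == b.1 then (true, b)
  else if i == (b.1 == 0%N :> nat) :> nat then (~~ b.2, b)
  else (false, (b.1, ~~ b.2)).

Variant letter_spec : letter -> Type :=
  | LetterX s : letter_spec (lx s)
  | LetterY s : letter_spec (ly s)
  | LetterZ s : letter_spec (lz s).

Lemma letterP a : letter_spec a.
Proof.
case: a => -[[|[|[|//]]] lt3] s; rewrite (bool_irrelevance lt3 isT);
  [exact: LetterX | exact: LetterY | exact: LetterZ].
Qed.

Lemma lact_color i b : (lact i b).2 = (b.1, (lact i b).2.2).
Proof.
by case: b => c s; rewrite /lact; case: (i == c) => //; case: (_ == _).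
Qed.

Definition letters_deg (ws : seq letter) : degree :=
  foldr (fun a g => deg_mul g (ldeg a)) deg1 ws.

(** [(e, (ws, ds))] stands for i^e times the composition of the skew derivations
[ds] followed by the right multiplications [ws], in both lists the last
operation first; see [value]. *)
Definition term := (nat * (seq letter * seq letter))%type.

(** The sign exponent in the commutation of the derivation [a] with the
multiplication by [b], on elements of degree [g]. *)
Definition cross (g : degree) (a b : letter) : bool :=
  let g' := deg_mul g (ldeg a) in
  (lact a.1 b).1 (+) twist g' (ldeg b) (ldeg a) (+) twist g' (ldeg a) (ldeg b).

(** Normal form of the derivation [a] applied to the monomial [(ws, ds)], on
elements of degree [g] that are killed by the derivations along the first two
modules, whence the empty list when such a derivation comes first. *)
Fixpoint push (g : degree) (a : letter) (ws ds : seq letter) : seq term :=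
  if ws is b :: ws' then
    (if a == b then [:: (0%N, (ws', ds))] else [::]) ++
    let g' := deg_mul (deg_mul g (letters_deg ds)) (letters_deg ws') in
    [seq ((t.1 + (cross g' a b).*2)%N, ((lact a.1 b).2 :: t.2.1, t.2.2))
      | t : term <- push g a ws' ds]
  else if (a.1 < 2)%N && (ds == [::]) then [::]
  else [:: (0%N, ([::], a :: ds))].

Definition rotate (e : nat) (ts : seq term) : seq term :=
  [seq ((e + t.1)%N, t.2) | t <- ts].

Definition derive (g : degree) (a : letter) (ts : seq term) : seq term :=
  flatten [seq rotate t.1 (push g a t.2.1 t.2.2) | t <- ts].

Definition mod4 (ts : seq term) : seq term :=
  [seq ((t.1 %% 4)%N, t.2) | t <- ts].

(** A sum of terms with coefficients powers of i vanishes formally when the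
multiset of its terms is stable under multiplication by i^2 = -1. *)
Definition cancels (ts : seq term) : bool :=
  perm_eq (mod4 ts) (mod4 (rotate 2 ts)).

(** P+ or P-, according to the sign s, as a list of words with powers of i.
With u = y_s z+ - z- y_s, the braided commutator of y_s and z+, the terms that
contain x+ are Q = - (x+ u - s u x+), a braided commutator of x+ and u; the
terms that contain x- are the multiple - i (h |> Q) of the translate of Q by h,
which makes the sum an eigenvector of h, since h acts with square -1 in degree
h. *)
Definition root_words (s : bool) : seq (nat * seq letter) :=
  let sg := (if s then 0 else 2)%N in
  [:: (2, [:: lx true; ly s; lz true]);
      (0%N, [:: lx true; lz false; ly s]);
      (sg, [:: ly s; lz true; lx true]);
      (sg + 2, [:: lz false; ly s; lx true])%N;
      (sg + 1, [:: lx false; ly (~~ s); lz false])%N;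
      (sg + 3, [:: lx false; lz true; ly (~~ s)])%N;
      (3, [:: ly (~~ s); lz false; lx false]);
      (1, [:: lz true; ly (~~ s); lx false])]%N.

(** The product of an element of degree [g] with the word [a b c] is the
left-bracketed word that extends it, up to this sign of reassociation. *)
Definition split_twist (g : degree) (ws : seq letter) : bool :=
  if ws is [:: a; b; c] then
    twist g (ldeg a) (ldeg b) (+) twist g (deg_mul (ldeg a) (ldeg b)) (ldeg c)
  else false.

Definition root_terms (s : bool) (g : degree) (ds : seq letter) : seq term :=
  [seq ((p.1 + (split_twist g p.2).*2)%N, (rev p.2, ds)) | p <- root_words s].

Definition coroot (s : bool) : seq letter := [:: lx true; ly s; lz true].

Definition derives g ds ts := foldr (derive g) ts ds.

Definition degh : degree := (true, true, true).

Lemma deg_mulA : associative deg_mul.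
Proof. by case=> [[? ?] ?] [[? ?] ?] [[? ?] ?]; rewrite /deg_mul /= !addbA. Qed.

Lemma deg_mulC : commutative deg_mul.
Proof.
case=> [[a1 a2] a3] [[b1 b2] b3].
by rewrite /deg_mul /= (addbC a1) (addbC a2) (addbC a3).
Qed.

Lemma deg_mul1 g : deg_mul g deg1 = g.
Proof. by case: g => [[a b] c]; rewrite /deg_mul /= !addbF. Qed.

Lemma deg_mulK g h : deg_mul (deg_mul g h) h = g.
Proof. by case: g h => [[? ?] ?] [[? ?] ?]; rewrite /deg_mul /= !addbK. Qed.

Lemma degh_stable g :
  g \in [:: deg1; degh] -> deg_mul g degh \in [:: deg1; degh].
Proof. by rewrite !inE => /orP[] /eqP->. Qed.

(** Only the commutation rule [straighten] of the multiplications and skew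
derivations of the tensor algebra matters in what follows. *)
Section Straightening.

Variables (k : fieldType) (T : lmodType k) (i : k).
Hypotheses (i2 : i ^+ 2 = -1) (char0 : [pchar k] =i pred0).
Variables (r d : letter -> {linear T -> T}) (homog : degree -> T -> Prop).
Hypothesis homog0 : forall g, homog g 0.
Hypothesis homog_lin : forall g c y z,
  homog g y -> homog g z -> homog g (c *: y + z).
Hypothesis homog_r : forall g a y,
  homog g y -> homog (deg_mul g (ldeg a)) (r a y).
Hypothesis homog_d : forall g a y,
  homog g y -> homog (deg_mul g (ldeg a)) (d a y).
Hypothesis straighten : forall g a b y, homog g y ->
  d a (r b y) = (a == b)%:R *: y
    + (-1) ^+ cross g a b *: r (lact a.1 b).2 (d a y).

Definition xy_constant (g : degree) (y : T) : Prop :=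
  homog g y /\ forall a : letter, (a.1 < 2)%N -> d a y = 0.

Definition monomial (ws ds : seq letter) (y : T) : T :=
  foldr (fun a z => r a z) (foldr (fun a z => d a z) y ds) ws.

Definition value (ts : seq term) (y : T) : T :=
  \sum_(t <- ts) i ^+ t.1 *: monomial t.2.1 t.2.2 y.

Lemma value_cat ts us y : value (ts ++ us) y = value ts y + value us y.
Proof. by rewrite /value big_cat. Qed.

Lemma value_rotate e ts y : value (rotate e ts) y = i ^+ e *: value ts y.
Proof.
rewrite /value big_map scaler_sumr; apply: eq_bigr => t _.
by rewrite exprD scalerA.
Qed.

Lemma value_cancels ts y : cancels ts -> value ts y = 0.
Proof.
have i4 : i ^+ 4 = 1 by rewrite (exprM i 2 2) i2 sqrrN expr1n.
have value_mod4 us : value (mod4 us) y = value us y.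
  rewrite /value big_map; apply: eq_bigr => t _ /=.
  by rewrite expr_mod.
move=> c; have : value (mod4 ts) y = value (mod4 (rotate 2 ts)) y.
  exact: perm_big.
rewrite !value_mod4 value_rotate i2 scaleN1r => /eqP.
rewrite -addr_eq0 -mulr2n -scaler_nat scaler_eq0 => /orP[|/eqP//].
by rewrite (pcharf0P k).1.
Qed.

Lemma homog_monomial g ws ds y :
  homog g y ->
  homog (deg_mul (deg_mul g (letters_deg ds)) (letters_deg ws))
    (monomial ws ds y).
Proof.
move=> Hy; elim: ws => [|a ws IHws] /=; last first.
  by rewrite deg_mulA; apply: homog_r.
elim: ds => [|a ds IHds] /=; first by rewrite !deg_mul1.
by move: (homog_d a IHds); rewrite !deg_mul1 deg_mulA.
Qed.

Lemma value_cons t ts y :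
  value (t :: ts) y = i ^+ t.1 *: monomial t.2.1 t.2.2 y + value ts y.
Proof. by rewrite /value big_cons. Qed.

Lemma pushE g a ws ds y : xy_constant g y ->
  d a (monomial ws ds y) = value (push g a ws ds) y.
Proof.
move=> [Hy ky]; elim: ws => [|b ws IHws] /=.
  case: ifP => [/andP[a2 /eqP->]|_]; first by rewrite /value big_nil; apply: ky.
  by rewrite /value big_seq1 expr0 scale1r.
rewrite (straighten _ _ (homog_monomial _ _ Hy)) value_cat; congr (_ + _).
  by case: eqP => _; rewrite /value ?big_nil ?scale0r // big_seq1 expr0.
rewrite IHws /value linear_sum big_map scaler_sumr; apply: eq_bigr => t _ /=.
rewrite linearZ /= scalerA exprD mulrC; congr (_ * _ *: _).
by rewrite -mul2n exprM i2.
Qed.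

Lemma deriveE g a ts y : xy_constant g y ->
  d a (value ts y) = value (derive g a ts) y.
Proof.
move=> Ky; elim: ts => [|t ts IHts]; first by rewrite /value !big_nil linear0.
rewrite value_cons linearD linearZ /= (pushE _ _ _ Ky) IHts.
by rewrite value_cat value_rotate.
Qed.

Lemma derivesE g ds ts y : xy_constant g y ->
  foldr (fun a z => d a z) (value ts y) ds = value (derives g ds ts) y.
Proof. by move=> Ky; elim: ds => //= a ds ->; apply: deriveE. Qed.

(** * The two root vectors *)

Definition root_mul (s : bool) (g : degree) (y : T) : T :=
  value (root_terms s g [::]) y.

Definition root_der (s : bool) (y : T) : T :=
  foldr (fun a z => d a z) y (coroot s).

Lemma value_root_terms s g ds y :
  value (root_terms s g ds) y = root_mul s g (foldr (fun a z => d a z) y ds).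
Proof. by rewrite /root_mul /value !big_map. Qed.

Lemma root_mul_linear s g : linear (root_mul s g).
Proof.
move=> c y z; rewrite /root_mul /value scaler_sumr -big_split.
apply: eq_bigr => t _ /=.
rewrite scalerA mulrC -scalerA -scalerDr; congr (_ *: _).
rewrite /monomial; elim: t.2.1 => [|a ws IHws] /=; last by rewrite IHws linearP.
by elim: t.2.2 => [//|a ds IHds] /=; rewrite IHds linearP.
Qed.

HB.instance Definition _ s g :=
  GRing.isLinear.Build k T T _ (root_mul s g) (root_mul_linear s g).

Lemma root_der_linear s : linear (root_der s).
Proof. by move=> c y z; rewrite /root_der /= !linearP. Qed.

HB.instance Definition _ s :=
  GRing.isLinear.Build k T T _ (root_der s) (root_der_linear s).

Lemma xy_constant_lin g c y z :
  xy_constant g y -> xy_constant g z -> xy_constant g (c *: y + z).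
Proof.
move=> [Hy ky] [Hz kz]; split=> [|a a2]; first exact: homog_lin.
by rewrite linearP ky // kz // scaler0 addr0.
Qed.

(** In particular P_s is killed by the derivations along the first two modules;
the proof straightens each of the finitely many cases. *)
Lemma root_mul_constant s g y : g \in [:: deg1; degh] -> xy_constant g y ->
  xy_constant (deg_mul g degh) (root_mul s g y).
Proof.
rewrite !inE => gh Ky; split=> [|a a2].
  have tdeg : all (fun t : term =>
      (letters_deg t.2.1 == degh) && (t.2.2 == [::])) (root_terms s g [::]).
    by case: s.
  rewrite /root_mul /value big_seq; apply: big_ind => [|y1 y2 Hy1 Hy2|t ts].
  - exact: homog0.
  - by rewrite -[y1]scale1r; apply: homog_lin.
  - rewrite -[_ *: _]addr0; apply: homog_lin => //.
    have /andP[/eqP <- /eqP->] := allP tdeg t ts.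
    by have := homog_monomial t.2.1 [::] Ky.1; rewrite /= deg_mul1.
rewrite /root_mul (deriveE _ _ Ky); apply: value_cancels.
have ax : a \in [:: lx true; lx false; ly true; ly false].
  by case: a a2 => -[[|[|//]] lt3] [] //= _; rewrite !inE /= -!val_eqE.
have: all (fun a => cancels (derive g a (root_terms s g [::])))
        [:: lx true; lx false; ly true; ly false].
  by case/orP: gh => /eqP->; case: s; vm_compute.
by move=> /allP/(_ _ ax).
Qed.

(** This is the Leibniz rule of the skew derivation dual to one of two
generators whose braiding is i times the flip. *)
Lemma root_der_mul s s' g y : g \in [:: deg1; degh] -> xy_constant g y ->
  root_der s' (root_mul s g y) =
  ((s == s')%:R * (i - 1)) *: y
    + i *: root_mul s (deg_mul g degh) (root_der s' y).
Proof.
rewrite !inE => gh Ky.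
(* The right hand side is moved to the left: 1 + i^3 = - (i - 1), i^3 = - i. *)
have c : cancels (derives g (coroot s') (root_terms s g [::]) ++
   (if s == s' then [:: (0%N, ([::], [::])); (3, ([::], [::]))]%N else [::]) ++
   rotate 3 (root_terms s (deg_mul g degh) (coroot s'))).
  by case/orP: gh => /eqP->; case: s; case: s'; vm_compute.
have := value_cancels y c; rewrite !value_cat -(derivesE _ _ Ky) value_rotate.
rewrite (value_root_terms _ (deg_mul g degh)) (exprS i 2) i2 mulrN1 scaleNr.
rewrite addrA => /eqP.
rewrite subr_eq0 => /eqP <-; rewrite addrCA -[LHS]addr0; congr (_ + _).
case: (s == s'); rewrite /value; last by rewrite big_nil mul0r scale0r addr0.
rewrite big_cons big_seq1 /= (exprS i 2) i2 -!scalerDl.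
by rewrite mul1r mulrN1 expr0 addrA subrK subrr scale0r.
Qed.

(** * Powers of the imaginary root vector *)

(** Right multiplication by Z = P+ P- - i P- P+. *)
Definition delta_mul (g : degree) (y : T) : T :=
  root_mul false (deg_mul g degh) (root_mul true g y)
    - i *: root_mul true (deg_mul g degh) (root_mul false g y).

Lemma delta_mul_constant g y :
  g \in [:: deg1; degh] -> xy_constant g y -> xy_constant g (delta_mul g y).
Proof.
move=> gh Ky; have gh' := degh_stable gh.
rewrite /delta_mul addrC -scaleNr; apply: xy_constant_lin;
  rewrite -[X in xy_constant X _](deg_mulK g degh);
  by apply: root_mul_constant => //; apply: root_mul_constant.
Qed.

(** D+ skew-commutes with the multiplication by Z: this is why the coefficient
of P- P+ in Z is -i. *)
Lemma root_der_delta_mul g y : g \in [:: deg1; degh] -> xy_constant g y ->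
  root_der true (delta_mul g y) =
    - delta_mul (deg_mul g degh) (root_der true y) /\
  root_der false (delta_mul g y) =
    (2%:R * (i - 1)) *: root_mul true g y
      - delta_mul (deg_mul g degh) (root_der false y).
Proof.
move=> gh Ky; have gh' := degh_stable gh.
have K1 s := root_mul_constant s gh Ky.
rewrite /delta_mul !linearB !linearZ /= !(root_der_mul _ _ gh' (K1 _)) deg_mulK.
rewrite !(root_der_mul _ _ gh Ky) /= !mul0r !mul1r !scale0r !add0r.
rewrite !linearD !linearZ /= ?scalerN ?opprK.
have ii (v : T) : i *: (i *: v) = - v by rewrite scalerA -expr2 i2 scaleN1r.
have ici (v : T) : i *: ((i - 1) *: (i *: v)) = - ((i - 1) *: v).
  by rewrite scalerA mulrC -scalerA ii scalerN.
rewrite !ii ici !opprK; split; first by rewrite addrACA subrr add0r.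
by rewrite addrACA mulr_natl mulr2n !scalerDl.
Qed.

Fixpoint delta_power (y : T) (n : nat) : T :=
  if n is n'.+1 then delta_mul deg1 (delta_power y n') else y.

Lemma delta_mul_linear g : linear (delta_mul g).
Proof.
by move=> c y z; rewrite /delta_mul !linearP /= addrACA -scalerDr.
Qed.

HB.instance Definition _ g :=
  GRing.isLinear.Build k T T _ (delta_mul g) (delta_mul_linear g).

(** The first three properties are carried along because they are needed to
apply the Leibniz rules at the next step. *)
Lemma delta_powerP y : homog deg1 y -> (forall a, d a y = 0) -> forall n,
  [/\ xy_constant deg1 (delta_power y n), root_der true (delta_power y n) = 0,
      xy_constant degh (root_der false (delta_power y n)) &
      root_der true (root_der false (delta_power y n.+1)) =
        ((n.+1)%:R * (2%:R * (i - 1) ^+ 2)) *: delta_power y n].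
Proof.
move=> Hy dy.
have h0 : deg1 \in [:: deg1; degh] by [].
have hh : degh \in [:: deg1; degh] by [].
have root_der0 s : root_der s y = 0 by rewrite /root_der /= dy !linear0.
have next z : xy_constant deg1 z -> root_der true z = 0 ->
    xy_constant degh (root_der false z) ->
    root_der true (root_der false (delta_mul deg1 z)) =
      (2%:R * (i - 1) ^+ 2) *: z
        + delta_mul deg1 (root_der true (root_der false z)).
  move=> K d1 K2; rewrite (root_der_delta_mul h0 K).2 linearB linearZ /=.
  rewrite (root_der_mul _ _ h0 K) d1 linear0 scaler0 addr0 mul1r scalerA.
  rewrite -mulrA -expr2.
  by rewrite (root_der_delta_mul hh K2).1 opprK.
elim=> [|n [K d1 K2 d2]].
  have K0 : xy_constant deg1 y by split.
  have Kh : xy_constant degh (root_der false y).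
    by rewrite root_der0; split=> [|a _]; rewrite ?linear0.
  by split=> //; rewrite next // !root_der0 linear0 linear0 addr0 mul1r.
have K' := delta_mul_constant h0 K.
have d1' : root_der true (delta_mul deg1 (delta_power y n)) = 0.
  by rewrite (root_der_delta_mul h0 K).1 d1 linear0 oppr0.
have K2' : xy_constant degh (root_der false (delta_mul deg1 (delta_power y n))).
  rewrite (root_der_delta_mul h0 K).2 addrC -scaleN1r.
  apply: xy_constant_lin; last first.
    rewrite -[_ *: _]addr0; apply: xy_constant_lin.
      exact: (root_mul_constant _ h0 K).
    by split=> [|a _]; rewrite ?linear0.
  exact: delta_mul_constant.
split=> //; rewrite next // -/(delta_power y n.+1) d2 linearZ /=.
by rewrite -scalerDl (mulrS 1 n.+1) (mulrDl 1 n.+1%:R) mul1r.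
Qed.

Lemma delta_power_notin (I : T -> Prop) y :
  homog deg1 y -> (forall a, d a y = 0) ->
  (forall c z, I z -> I (c *: z)) -> (forall a z, I z -> I (d a z)) ->
  ~ I y -> forall n, ~ I (delta_power y n).
Proof.
move=> Hy dy IZ Id Iy; elim=> // n IHn In; apply: IHn.
have I_root_der s z : I z -> I (root_der s z) by move=> Iz; apply/Id/Id/Id.
have [_ _ _ e] := delta_powerP Hy dy n.
have {}In : I (((n.+1)%:R * (2%:R * (i - 1) ^+ 2)) *: delta_power y n).
  by rewrite -e; apply/I_root_der/I_root_der.
have nz : (n.+1)%:R * (2%:R * (i - 1) ^+ 2) != 0.
  have char m : (m.+1)%:R != 0 :> k by rewrite (pcharf0P k).1.
  have i1 : i - 1 != 0.
    rewrite subr_eq0; apply/eqP => i1; move/eqP: i2.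
    by rewrite i1 expr1n -addr_eq0 -mulr2n; apply/negP/char.
  apply: mulf_neq0; first exact: char.
  by apply: mulf_neq0; [exact: char | exact: expf_neq0].
by rewrite -[delta_power y n]scale1r -(mulVf nz) -scalerA; apply: IZ.
Qed.

(** For [S m] the elements of degree [m], this says that Z has degree 6. *)
Lemma delta_power_closed (S : nat -> T -> Prop) y :
  (forall m, S m 0) ->
  (forall m c z t, S m z -> S m t -> S m (c *: z + t)) ->
  (forall m a z, S m z -> S m.+1 (r a z)) -> S 0%N y ->
  forall n, S (6 * n)%N (delta_power y n).
Proof.
move=> S0 Slin Sr Sy.
have S_root s g m z : S m z -> S (m + 3)%N (root_mul s g z).
  move=> Sz.
  have tsize : all (fun t : term => (size t.2.1 == 3%N) && (t.2.2 == [::]))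
                 (root_terms s g [::]) by case: s.
  rewrite /root_mul /value big_seq; apply: big_ind => [|z1 z2 S1 S2|t ts].
  - exact: S0.
  - by rewrite -[z1]scale1r; apply: Slin.
  - rewrite -[_ *: _]addr0; apply: Slin => //.
    have /andP[/eqP sz /eqP->] := allP tsize t ts.
    suff: S (m + size t.2.1)%N (monomial t.2.1 [::] z) by rewrite sz.
    rewrite /monomial /=; elim: t.2.1 => [|a ws IHws]; first by rewrite addn0.
    by rewrite addnS; apply: Sr.
elim=> [|n IHn] //=; rewrite mulnS addnC -[6%N]/(3 + 3)%N addnA.
rewrite /delta_mul addrC -scaleNr.
by apply: Slin; apply/S_root/S_root.
Qed.

End Straightening.

(** * Bases of the modules *)

(** An eigenvector of [P] with eigenvalue 1 exists because [P] = -1 would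
commute with [Q]; its image under [Q] has eigenvalue -1. *)
Lemma pauli_pair (k : fieldType) (V : vectType k) (P Q : 'End(V)) :
  (2%:R : k) != 0 -> fullv <> 0%VS :> {vspace V} ->
  (forall v, P (P v) = v) -> (forall v, Q (Q v) = v) ->
  (forall v, P (Q v) = - Q (P v)) ->
  exists (e : bool -> V) (phi : bool -> V -> k),
    [/\ forall s, linear (phi s : V -> k^o),
        forall s t, phi s (e t) = (s == t)%:R,
        forall s, P (e s) = (-1) ^+ (~~ s) *: e s
      & forall s, Q (e s) = e (~~ s)].
Proof.
move=> nz2 V0 PP QQ PQ.
have dbl (v : V) : v + v = 0 -> v = 0.
  by move=> /eqP; rewrite -mulr2n -scaler_nat scaler_eq0 (negPf nz2) => /eqP.
have [u u0 Pu] : exists2 u, u != 0 & P u = u.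
  have w0 : vpick (fullv : {vspace V}) != 0 by rewrite vpick0; apply/eqP.
  set w := vpick _ in w0; have [uw|uw] := eqVneq (w + P w) 0; last first.
    by exists (w + P w) => //; rewrite linearD /= PP addrC.
  have Pw : P w = - w by apply/eqP; rewrite -addr_eq0 addrC uw.
  exists (Q w); last by rewrite PQ Pw linearN opprK.
  by apply: contraNneq w0 => Qw; rewrite -(QQ w) Qw linear0.
pose e s := if s then u else Q u.
have fr : free [:: u; Q u].
  rewrite free_cons seq1_free span_seq1; apply/andP; split; last first.
    by apply: contraNneq u0 => Qu; rewrite -(QQ u) Qu linear0.
  apply: contraNN u0 => /vlineP[c uc]; apply/eqP/dbl.
  by rewrite -{1}Pu {1}uc linearZ /= PQ Pu scalerN -uc addNr.
pose X := [tuple u; Q u].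
pose o (s : bool) : 'I_2 := if s then ord0 else ord_max.
have eX s : e s = X`_(o s) by case: s.
exists e, (fun s => coord X (o s)); split.
- by move=> s; apply: linearP.
- by move=> s t; rewrite eX coord_free //; case: s; case: t.
- by case; rewrite /e /= ?expr0 ?scale1r ?expr1 ?scaleN1r // PQ Pu.
- by case; rewrite /e /= ?QQ.
Qed.

(** * Coordinates of vectors in the chosen homogeneous bases *)

Section Coordinates.
Variables (k : fieldType) (gT : finGroupType) (omega : gT -> gT -> gT -> k).
Variables (V : vectType k) (M : yd_module omega V).

(** The vector [v] of the component [g], as an element of the free module on the
chosen basis. *)
Definition coords (g : gT) (v : V) : kfree k (hidx M) :=
  \sum_(j < \dim (yd_comp M g)) coord (vbasis (yd_comp M g)) j v
    *: bvec k (Tagged (fun g => 'I_(\dim (yd_comp M g))) j : hidx M).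

Definition component_functional (g : gT) (phi : V -> k) (b : hidx M) : k :=
  if tag b == g then phi (hvec b) else 0.

Lemma coords_linear g : linear (coords g).
Proof.
move=> c v w; rewrite /coords scaler_sumr -big_split; apply: eq_bigr => j _.
by rewrite linearP scalerDl scalerA.
Qed.
HB.instance Definition _ g :=
  GRing.isLinear.Build k V (kfree k (hidx M)) _ (coords g) (coords_linear g).

Lemma hactE e b : hact e b = coords (tag b) (yd_act M e (hvec b)).
Proof. by []. Qed.

Lemma coords_supported g v :
  supported (fun b : hidx M => tag b == g) (coords g v).
Proof.
rewrite /coords; apply: big_ind => [||j _]; first exact: supported0.
  exact: supportedD.
by apply/supportedZ/supported_bvec => /=.
Qed.

Lemma mext_coords (W : lmodType k) (f : hidx M -> W) g v :
  mext f (coords g v) = \sum_(j < \dim (yd_comp M g))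
    coord (vbasis (yd_comp M g)) j v *:
    f (Tagged (fun g => 'I_(\dim (yd_comp M g))) j : hidx M).
Proof.
rewrite /coords linear_sum; apply: eq_bigr => j _.
by rewrite linearZ /= mext_bvec.
Qed.

Lemma coords_act e g v : v \in yd_comp M g ->
  mext (hact e) (coords g v) = coords g (yd_act M e v).
Proof.
move=> vg; rewrite mext_coords [in RHS](coord_vbasis vg) !linear_sum.
by apply: eq_bigr => j _; rewrite !linearZ.
Qed.

Lemma functional_coords g h (phi : V -> k) v : linear (phi : V -> k^o) ->
  v \in yd_comp M h ->
  mext (component_functional g phi : hidx M -> k^o) (coords h v) =
  (if h == g then phi v else 0).
Proof.
move=> lin vh; rewrite mext_coords /component_functional /=.
case: eqP => _; last by rewrite big1 // => j _; rewrite scaler0.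
pose phiL : {linear V -> k^o} :=
  HB.pack (phi : V -> k^o) (GRing.isLinear.Build k V k^o _ phi lin).
rewrite -[phi v]/(phiL v) {2}(coord_vbasis vh) linear_sum.
by apply: eq_bigr => j _; rewrite linearZ.
Qed.

Lemma hact1 (b : hidx M) : hact 1%g b = bvec k b.
Proof.
rewrite hactE yd_act1 /coords /hvec; case: b => g j /=.
have fr := basis_free (vbasisP (yd_comp M g)).
rewrite (bigD1 j) //= coord_free // eqxx scale1r.
rewrite big1 ?addr0 // => j' nj; rewrite coord_free //.
by rewrite eq_sym (negPf nj) scale0r.
Qed.

End Coordinates.

(** * The group and the cocycle *)

Section ElementaryAbelian.
Variables (gT : finGroupType) (g1 g2 g3 : gT).
Hypotheses (og1 : #[g1]%g = 2%N) (og2 : #[g2]%g = 2%N) (og3 : #[g3]%g = 2%N).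
Hypothesis defG : (<[g1]> \x <[g2]> \x <[g3]>)%g = [set: gT].

Definition elt (g : degree) : gT := (g1 ^+ g.1.1 * g2 ^+ g.1.2 * g3 ^+ g.2)%g.

Lemma expg_addb (x : gT) (a b : bool) : #[x]%g = 2%N ->
  (x ^+ a * x ^+ b = x ^+ (a (+) b)%R)%g.
Proof.
move=> ox; have xx : (x * x = 1)%g by have := expg_order x; rewrite ox.
by case: a; case: b; rewrite /= ?mulg1 ?mul1g ?xx.
Qed.

Lemma commute_generators : [/\ commute g2 g1, commute g3 g1 & commute g3 g2].
Proof.
have [[K L eK eL] eG cK _] := dprodP defG.
have [_ e12 c12 _] := dprodP eK.
rewrite eK -e12 in cK.
have in1 : g1 \in (<[g1]> * <[g2]>)%g.
  by rewrite (subsetP (mulG_subl _ _)) ?cycle_id.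
have in2 : g2 \in (<[g1]> * <[g2]>)%g.
  by rewrite (subsetP (mulG_subr _ _)) ?cycle_id.
split; first by apply: (centsP c12); rewrite cycle_id.
- by apply: (centsP cK); rewrite ?cycle_id.
- by apply: (centsP cK); rewrite ?cycle_id.
Qed.

Lemma elt_mul g h : elt (deg_mul g h) = (elt g * elt h)%g.
Proof.
have [c21 c31 c32] := commute_generators.
rewrite /elt /deg_mul /=.
rewrite -!(expg_addb _ _ og1) -!(expg_addb _ _ og2) -!(expg_addb _ _ og3).
have := commuteX2 g.1.2 h.1.1 c21; have := commuteX2 g.2 h.1.1 c31.
have := commuteX2 g.2 h.1.2 c32; rewrite /commute.
move: (g1 ^+ g.1.1)%g (g1 ^+ h.1.1)%g (g2 ^+ g.1.2)%g (g2 ^+ h.1.2)%g.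
move: (g3 ^+ g.2)%g (g3 ^+ h.2)%g.
move=> x3 y3 x1 y1 x2 y2 c32' c31' c21'; rewrite -!mulgA; congr (_ * _)%g.
rewrite [(x3 * (y1 * _))%g]mulgA c31' -mulgA.
rewrite [(x2 * (y1 * _))%g]mulgA c21' -mulgA.
by do 2! congr (_ * _)%g; rewrite !mulgA c32'.
Qed.

Lemma elt1 : elt deg1 = 1%g.
Proof. by rewrite /elt /= !mulg1. Qed.

Lemma elt_surj x : exists g, x = elt g.
Proof.
have [[K L eK eL] eG cK _] := dprodP defG.
have [_ e12 c12 _] := dprodP eK.
have bit (y z : gT) : #[y]%g = 2%N -> z \in <[y]>%g ->
    exists b : bool, z = (y ^+ b)%g.
  move=> oy /cyclePmin[m]; rewrite oy => lt2 ->.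
  by exists (m == 1)%N; case: m lt2 => [|[|]].
have : x \in [set: gT]%g by rewrite inE.
rewrite -eG eK -e12 => /mulsgP[_ z3 /mulsgP[z1 z2 i1 i2 ->] i3 ->].
have [b1 ->] := bit _ _ og1 i1; have [b2 ->] := bit _ _ og2 i2.
by have [b3 ->] := bit _ _ og3 i3; exists (b1, b2, b3).
Qed.

Lemma elt_comm (x y : gT) : (x * y = y * x)%g.
Proof.
have [g ->] := elt_surj x; have [h ->] := elt_surj y.
by rewrite -!elt_mul deg_mulC.
Qed.

Variables (k : fieldType) (omega : gT -> gT -> gT -> k).
Hypothesis omegaE : forall i1 i2 i3 j1 j2 j3 l1 l2 l3 : 'I_2,
     omega (g1 ^+ i1 * g2 ^+ i2 * g3 ^+ i3)%g
           (g1 ^+ j1 * g2 ^+ j2 * g3 ^+ j3)%g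
           (g1 ^+ l1 * g2 ^+ l2 * g3 ^+ l3)%g = (-1) ^+ (l1 * j2 * i3)%N.

Lemma omega_elt a b c : omega (elt a) (elt b) (elt c) = (-1) ^+ twist a b c.
Proof.
pose o (s : bool) : 'I_2 := @Ordinal 2 s (leq_b1 s).
have := omegaE (o a.1.1) (o a.1.2) (o a.2) (o b.1.1) (o b.1.2) (o b.2)
  (o c.1.1) (o c.1.2) (o c.2).
by rewrite /elt /twist /= => ->; case: a.2; case: b.1.2; case: c.1.1.
Qed.

Lemma omega1l x y : omega 1%g x y = 1.
Proof.
have [a ->] := elt_surj x; have [b ->] := elt_surj y.
by rewrite -elt1 omega_elt.
Qed.

Lemma omega1m x y : omega x 1%g y = 1.
Proof.
have [a ->] := elt_surj x; have [b ->] := elt_surj y.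
by rewrite -elt1 omega_elt /twist andbF.
Qed.

Lemma omega1r x y : omega x y 1%g = 1.
Proof.
have [a ->] := elt_surj x; have [b ->] := elt_surj y.
by rewrite -elt1 omega_elt /twist !andbF.
Qed.

Lemma act_elt (V : vectType k) (M : yd_module omega V) (c a b : degree) v :
  yd_has_deg M (elt c) ->
  yd_act M (elt a) (yd_act M (elt b) v) =
  (-1) ^+ (twist c a b (+) twist a b c (+) twist a c b)
    *: yd_act M (elt (deg_mul a b)) v.
Proof.
move=> degM; have vc : v \in yd_comp M (elt c) by rewrite degM memvf.
rewrite (yd_actM _ _ vc) /act_coef !omega_elt elt_mul; congr (_ *: _).
by case: twist; case: twist; case: twist;
  rewrite /= ?expr1 ?expr0 ?invrN ?invr1 ?(mulr1, mulrN1, opprK).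
Qed.

End ElementaryAbelian.

(** * Letters inside the tensor algebra *)

Section Main.
Variables (gT : finGroupType) (g1 g2 g3 : gT).
Hypotheses (og1 : #[g1]%g = 2%N) (og2 : #[g2]%g = 2%N) (og3 : #[g3]%g = 2%N).
Hypothesis defG : (<[g1]> \x <[g2]> \x <[g3]>)%g = [set: gT].
Variables (k : closedFieldType) (char0 : [pchar k] =i pred0).
Variable omega : gT -> gT -> gT -> k.
Hypothesis omegaE : forall i1 i2 i3 j1 j2 j3 l1 l2 l3 : 'I_2,
     omega (g1 ^+ i1 * g2 ^+ i2 * g3 ^+ i3)%g
           (g1 ^+ j1 * g2 ^+ j2 * g3 ^+ j3)%g
           (g1 ^+ l1 * g2 ^+ l2 * g3 ^+ l3)%g = (-1) ^+ (l1 * j2 * i3)%N.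

Local Notation elt := (elt g1 g2 g3).

Lemma char0_natr m : (m.+1)%:R != 0 :> k.
Proof. by rewrite (pcharf0P k).1. Qed.

(** The two generators of the group that are not in the degree of the module
anticommute on it because of the cocycle, so that [pauli_pair] applies. *)
Lemma letter_basis (c : 'I_3) (V : vectType k) (M : yd_module omega V) :
  yd_simple M -> yd_has_deg M (elt (ldeg (c, true))) ->
  (forall v, yd_act M (elt (ldeg (c, true))) v = - v) ->
  exists (e : bool -> V) (phi : bool -> V -> k),
    [/\ forall s, linear (phi s : V -> k^o),
        forall s t, phi s (e t) = (s == t)%:R
      & forall (i : 'I_3) s, yd_act M (elt (ldeg (i, true))) (e s) =
          (-1) ^+ (lact i (c, s)).1 *: e (lact i (c, s)).2.2].
Proof.
move=> [V0 _] degM actM.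
pose f (n : nat) : degree := (n == 0, n == 1, n == 2)%N.
pose p := if c == 0%N :> nat then 1%N else 0%N.
pose q := if c == 2%N :> nat then 1%N else 2%N.
have act1 v : yd_act M (elt deg1) v = v by rewrite elt1 yd_act1.
have rel a b v := act_elt og1 og2 og3 defG omegaE a b v degM.
have nz2 : (2%:R : k) != 0 := char0_natr 1.
have [|||e [phi [lin dual eP eQ]]] := pauli_pair (P := yd_act M (elt (f p)))
    (Q := yd_act M (elt (f q))) nz2 V0.
- move=> v; rewrite rel; move: c @p @q {degM rel actM} => [[|[|[|//]]] lt3] /=;
    by rewrite act1 expr0 scale1r.
- move=> v; rewrite rel; move: c @p @q {degM rel actM} => [[|[|[|//]]] lt3] /=;
    by rewrite act1 expr0 scale1r.
- move=> v; rewrite !rel deg_mulC.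
  move: c @p @q {degM rel actM} => [[|[|[|//]]] lt3] /=;
    by rewrite expr0 expr1 scale1r scaleN1r ?opprK.
exists e, phi; split=> // i s.
case: c @p @q degM rel actM eP eQ => [[|[|[|//]]] lt3] p q degM rel actM eP eQ;
  case: i => [[|[|[|//]]] lt3'];
  first [by rewrite actM scaleN1r | by rewrite [LHS]eP
        | by rewrite [LHS]eQ scale1r].
Qed.

Section Letters.
Variables (V : vectType k) (M : yd_module omega V).
Variables (e : letter -> V) (phi : letter -> V -> k).
Hypotheses (phi_lin : forall a, linear (phi a : V -> k^o))
  (phi_e : forall a b, phi a (e b) = (a == b)%:R)
  (e_deg : forall b, e b \in yd_comp M (elt (ldeg b)))
  (e_act : forall a b : letter, yd_act M (elt (ldeg a)) (e b) =
     (-1) ^+ (lact a.1 b).1 *: e (lact a.1 b).2).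

Local Notation A := (byd_of M).
Local Notation T := (kfree k (word A)).

Definition rletter (a : letter) : {linear T -> T} :=
  @letter_mul k gT A (coords M (elt (ldeg a)) (e a)).

Definition dletter (a : letter) : {linear T -> T} :=
  @partial k gT omega A (component_functional (elt (ldeg a)) (phi a)).

Definition of_degree (g : degree) (x : T) : Prop :=
  supported (fun w : word A => wdeg w == elt g) x.

Let o1l := omega1l og1 og2 og3 defG omegaE.
Let o1m := omega1m og1 og2 og3 defG omegaE.
Let o1r := omega1r og1 og2 og3 defG omegaE.
Let gC := elt_comm og1 og2 og3 defG.

Lemma functional_deg a (b : A) :
  component_functional (elt (ldeg a)) (phi a) b != 0 -> bdeg b = elt (ldeg a).
Proof.
by rewrite /component_functional; have [//|_ /eqP] := eqVneq (tag b).
Qed.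

Lemma bact_supported h (b : A) :
  supported (fun c : A => bdeg c == bdeg b) (bact h b).
Proof. by rewrite /= hactE; apply: coords_supported. Qed.

Lemma bact1 (b : A) : bact 1%g b = bvec k b.
Proof. exact: hact1. Qed.

Lemma coords_degree g v : supported (fun c : A => bdeg c == g) (coords M g v).
Proof. exact: coords_supported. Qed.

Lemma rletter_deg g a y :
  of_degree g y -> of_degree (deg_mul g (ldeg a)) (rletter a y).
Proof.
move=> sy; rewrite /of_degree (elt_mul og1 og2 og3 defG).
exact: letter_mul_deg (@coords_degree _ _) sy.
Qed.

Lemma dletter_deg g a y :
  of_degree g y -> of_degree (deg_mul g (ldeg a)) (dletter a y).
Proof.
rewrite /of_degree -{1}(deg_mulK g (ldeg a)) (elt_mul og1 og2 og3 defG) => sy.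
have := partial_deg o1l o1m o1r gC bact_supported bact1 (@functional_deg a) sy.
by apply: supported_sub => w; rewrite (inj_eq (mulIg _)).
Qed.

Lemma dletter_rletter g a b y : of_degree g y ->
  dletter a (rletter b y) = (a == b)%:R *: y +
    (-1) ^+ cross g a b *: rletter (lact a.1 b).2 (dletter a y).
Proof.
rewrite /of_degree -{1}(deg_mulK g (ldeg a)) (elt_mul og1 og2 og3 defG) => sy.
have phiE : mext (component_functional (elt (ldeg a)) (phi a) : A -> k^o)
    (coords M (elt (ldeg b)) (e b)) = (a == b)%:R.
  apply: etrans (functional_coords _ (phi_lin a) (e_deg b)) _.
  rewrite phi_e; case: eqVneq => // nab.
  by case: (eqVneq a b) nab => // ->; rewrite eqxx.
have actE :
    mext (bact (b := A) (elt (ldeg a))) (coords M (elt (ldeg b)) (e b)) =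
    (-1) ^+ (lact a.1 b).1 *: coords M (elt (ldeg b)) (e (lact a.1 b).2).
  apply: etrans (coords_act _ (e_deg b)) _.
  by rewrite e_act linearZ.
have E := partial_letter_mul o1l o1m o1r gC bact_supported bact1
   (@functional_deg a) (@coords_degree (elt (ldeg b)) (e b)) sy.
apply: etrans E _.
rewrite [X in X *: _ + _]phiE.
rewrite [X in letter_mul X _]actE.
rewrite letter_mulZl.
rewrite !(omega_elt omegaE).
have lb : ldeg (lact a.1 b).2 = ldeg b by rewrite lact_color.
have rE : letter_mul (A := A) (coords M (elt (ldeg b)) (e (lact a.1 b).2))
  (partial omega (A := A) (component_functional (elt (ldeg a)) (phi a)) y) =
  rletter (lact a.1 b).2 (dletter a y) by rewrite /= lb.
rewrite rE scalerA.
have sE : (-1) ^+ twist (deg_mul g (ldeg a)) (ldeg b) (ldeg a)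
   / (-1) ^+ twist (deg_mul g (ldeg a)) (ldeg a) (ldeg b)
   * (-1) ^+ (lact a.1 b).1
   = (-1) ^+ cross g a b :> k.
  rewrite /cross; case: (lact _ _).1; case: twist; case: twist;
  by rewrite /= ?expr1 ?expr0 ?invrN ?invr1 ?(mulr1, mulrN1, opprK).
by rewrite sE.
Qed.

Lemma letters_infinite : ~ nichols_finite_dim omega A.
Proof.
have [i i2] : exists i : k, i ^+ 2 = -1.
  have [i iE] := @solve_monicpoly k 2 (fun j => if j == 0%N then -1 else 0) isT.
  by exists i; rewrite iE !big_ord_recl big_ord0 /= mulr1 mul0r !addr0.
have [I0 ID] := nichols_ideal_subspace omega A.
have IZ c z : nichols_ideal omega (A := A) z ->
    nichols_ideal omega (A := A) (c *: z).
  by move=> Iz; rewrite -[c *: z]addr0; apply: ID.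
pose one : T := bvec k ([::] : word A).
have one_deg : of_degree deg1 one.
  by apply: supported_bvec; rewrite /= (elt1 g1 g2 g3).
have one_notin : ~ nichols_ideal omega one.
  move=> /nichols_ideal_supported/(_ [::]).
  by rewrite -mcoeff_neq0 mcoeffUU oner_eq0 => /(_ isT).
have d_one a : dletter a one = 0 by apply: partial_nil.
have deg_lin g c (y z : T) :
    of_degree g y -> of_degree g z -> of_degree g (c *: y + z).
  by move=> gy gz; apply: supportedD => //; apply: supportedZ.
move=> /nichols_finite_dim_degree[N HN].
apply: (delta_power_notin i2 char0 (fun g => @supported0 _ _ _) deg_lin
   rletter_deg dletter_deg dletter_rletter one_deg d_one IZ
   (fun a z => @nichols_ideal_partial _ _ _ _ _ z) one_notin (n := N)).
apply: (HN (6 * N)%N); first by rewrite leq_pmull.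
apply: (@delta_power_closed _ _ i rletter dletter
  (fun m => supported (fun w : word A => size w == m))).
- by move=> m; apply: supported0.
- by move=> m c z t sz st; apply: supportedD => //; apply: supportedZ.
- by move=> m a z; apply: letter_mul_size.
- exact: supported_bvec.
Qed.

End Letters.

End Main.

(** * Infinite dimension *)

Theorem theorem1p3
  (k : closedFieldType) (char0 : [pchar k] =i pred0)
  (gT : finGroupType) (g1 g2 g3 : gT)
  (og1 : #[g1]%g = 2%N) (og2 : #[g2]%g = 2%N) (og3 : #[g3]%g = 2%N)
  (defG : (<[g1]> \x <[g2]> \x <[g3]>)%g = [set: gT])
  (omega : gT -> gT -> gT -> k)
  (omegaE : forall i1 i2 i3 j1 j2 j3 l1 l2 l3 : 'I_2,
     omega (g1 ^+ i1 * g2 ^+ i2 * g3 ^+ i3)%g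
           (g1 ^+ j1 * g2 ^+ j2 * g3 ^+ j3)%g
           (g1 ^+ l1 * g2 ^+ l2 * g3 ^+ l3)%g = (-1) ^+ (l1 * j2 * i3)%N)
  (V1 V2 V3 : vectType k)
  (M1 : yd_module omega V1) (M2 : yd_module omega V2)
  (M3 : yd_module omega V3)
  (simpleM1 : yd_simple M1) (simpleM2 : yd_simple M2) (simpleM3 : yd_simple M3)
  (dimV1 : \dim (fullv : {vspace V1}) = 2%N)
  (dimV2 : \dim (fullv : {vspace V2}) = 2%N)
  (dimV3 : \dim (fullv : {vspace V3}) = 2%N)
  (degM1 : yd_has_deg M1 g1) (degM2 : yd_has_deg M2 g2)
  (degM3 : yd_has_deg M3 g3)
  (actM1 : forall v : V1, yd_act M1 g1 v = - v)
  (actM2 : forall v : V2, yd_act M2 g2 v = - v)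
  (actM3 : forall v : V3, yd_act M3 g3 v = - v) :
  ~ nichols_finite_dim omega (byd_of (yd_sum (yd_sum M1 M2) M3)).
Proof.
pose c1 := (lx true).1; pose c2 := (ly true).1; pose c3 := (lz true).1.
have E1 : elt g1 g2 g3 (ldeg (c1, true)) = g1 by rewrite /elt /= expg1 !mulg1.
have E2 : elt g1 g2 g3 (ldeg (c2, true)) = g2.
  by rewrite /elt /= expg1 mulg1 mul1g.
have E3 : elt g1 g2 g3 (ldeg (c3, true)) = g3 by rewrite /elt /= expg1 !mul1g.
have [e1 [phi1 [lin1 dual1 act1]]] := letter_basis og1 og2 og3 defG char0
  omegaE (c := c1) simpleM1 (etrans (congr1 (yd_comp M1) E1) degM1)
  (fun v => etrans (congr1 (fun g => yd_act M1 g v) E1) (actM1 v)).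
have [e2 [phi2 [lin2 dual2 act2]]] := letter_basis og1 og2 og3 defG char0
  omegaE (c := c2) simpleM2 (etrans (congr1 (yd_comp M2) E2) degM2)
  (fun v => etrans (congr1 (fun g => yd_act M2 g v) E2) (actM2 v)).
have [e3 [phi3 [lin3 dual3 act3]]] := letter_basis og1 og2 og3 defG char0
  omegaE (c := c3) simpleM3 (etrans (congr1 (yd_comp M3) E3) degM3)
  (fun v => etrans (congr1 (fun g => yd_act M3 g v) E3) (actM3 v)).
pose e (a : letter) : (V1 * V2 * V3)%type :=
  if a.1 == c1 then (e1 a.2, 0, 0)
  else if a.1 == c2 then (0, e2 a.2, 0) else (0, 0, e3 a.2).
pose phi (a : letter) (v : V1 * V2 * V3) : k :=
  if a.1 == c1 then phi1 a.2 v.1.1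
  else if a.1 == c2 then phi2 a.2 v.1.2 else phi3 a.2 v.2.
have lin0 (V : vectType k) (f : V -> k) : linear (f : V -> k^o) -> f 0 = 0.
  by move=> lf; have := lf (-1) 0 0; rewrite scaler0 addr0 scaleN1r addNr.
have sumE W1 W2 (N1 : yd_module omega W1) (N2 : yd_module omega W2) h v1 v2 :
    yd_act (yd_sum N1 N2) h (v1, v2) = (yd_act N1 h v1, yd_act N2 h v2).
  by rewrite lfunE.
have pairZ (W1 W2 : vectType k) (c : k) (v1 : W1) (v2 : W2) :
    c *: (v1, v2) = (c *: v1, c *: v2) by [].
apply: (letters_infinite og1 og2 og3 defG char0 omegaE (e := e) (phi := phi)).
- move=> a c v w; rewrite /phi; case: ifP => _; first exact: lin1.
  by case: ifP => _; [exact: lin2 | exact: lin3].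
- move=> a b; case: (letterP a) => s; case: (letterP b) => t;
  by rewrite /phi /e /= ?(dual1, dual2, dual3)
     ?(lin0 _ _ (lin1 _), lin0 _ _ (lin2 _), lin0 _ _ (lin3 _)).
- move=> b; case: (letterP b) => s;
  by rewrite !mem_sum_comp /e /= ?mem0v ?E1 ?E2 ?E3 ?degM1 ?degM2 ?degM3 ?memvf.
- move=> a b; rewrite (lact_color a.1 b); case: (letterP b) => s.
- by rewrite /e /= !sumE !linear0 [yd_act M1 _ _](act1 a.1 s) !pairZ !scaler0.
- by rewrite /e /= !sumE !linear0 [yd_act M2 _ _](act2 a.1 s) !pairZ !scaler0.
- by rewrite /e /= !sumE !linear0 [yd_act M3 _ _](act3 a.1 s) !pairZ !scaler0.
Qed.
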